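(* Let $d>1$ and let $G$ be a subgroup of $\mathrm{Aut}(\mathcal T_d)$ generated by a reversible automaton. Then: (i) The recursion morphism $\Phi:\mathbb C G\to M_d(\mathbb C G)$ extends to an isometry from $C^*_\lambda(G)$ into $M_d(C^*_\lambda(G))$: $$\Phi: C^*_\lambda(G)\hookrightarrow M_d(C^*_\lambda(G)).$$ (ii) For all $n\in\mathbb N$, there exists a conditional expectation $E_n$ from $M_{d^n}(C^*_\lambda(G))$ onto $C^*_\lambda(G)$, the latter being identified with its image in $M_{d^n}(C^*_\lambda(G))$ via $\Phi^{(n)}$: $$E_n: M_{d^n}(C^*_\lambda(G))\twoheadrightarrow\Phi^{(n)}(C^*_\lambda(G)).$$
   Context: Let $X=\{1,\dots,d\}$ and let $\mathcal T_d$ be the $d$-regular rooted tree with vertex set $X^*$, root the empty word, each $w$ joined to $wx$, $x\in X$; $L_n=X^n$ is the $n$-th level and $v\mathcal T_d$ is the subtree of vertices having $v$ as a prefix. $\mathrm{Aut}(\mathcal T_d)$ is the group of rooted tree automorphisms. For $g\in\mathrm{Aut}(\mathcal T_d)$ and a vertex $v$, $\varphi_{g(v)}(g)\in\mathrm{Aut}(\mathcal T_d)$ is the automorphism obtained from the isomorphism $g:v\mathcal T_d\to g(v)\mathcal T_d$ by identifying both subtrees with $\mathcal T_d$, i.e. $g(vw)=g(v)\,\varphi_{g(v)}(g)(w)$ for all $w\in X^*$. A subgroup $G$ is generated by an automaton if it has a finite generating set $S$ with $\varphi_v(g)\in S$ for all $g\in S$, $v\in L_1$; then $\varphi_v(g)\in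 G$ for all $g\in G$ and all vertices $v$. $G$ is said to be generated by a reversible automaton if it is generated by an automaton and acts topologically freely on the boundary of $\mathcal T_d$, i.e. for every vertex $v$ the only element of $G$ fixing every point of $v\mathcal T_d$ is $1$. For $g\in G$, $\Phi^{(n)}(g)$ is the $d^n\times d^n$ matrix indexed by $L_n$ whose $(g(v),v)$ entry is $\varphi_{g(v)}(g)$ for each $v\in L_n$ and whose other entries are $0$; extended linearly, this gives a $*$-homomorphism $\Phi^{(n)}:\mathbb C G\to M_{d^n}(\mathbb C G)$, and $\Phi=\Phi^{(1)}$ is the recursion morphism. $\Phi^{(n)}$ also denotes the extension to $C^*_\lambda(G)$ (the $n$-fold iterate of the extension of $\Phi$ from (i), applied entrywise). $C^*_\lambda(G)$ is the reduced $C^*$-algebra of the discrete group $G$, in which $\mathbb C G$ is viewed as a dense subalgebra via the left regular representation $\lambda$. *)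

(* Defs.v *)
From HB Require Import structures.
From mathcomp Require Import all_boot all_order all_algebra finmap.
From mathcomp Require Import complex.
From mathcomp Require Import all_classical all_reals all_analysis.
From mathcomp.analysis.showcase Require summability.
From mathcomp Require Import ring lra.
Set Implicit Arguments.
Unset Strict Implicit.
Unset Printing Implicit Defensive.
Import Order.TTheory GRing.Theory Num.Theory numFieldNormedType.Exports.
Local Open Scope classical_set_scope.
Local Open Scope ring_scope.
Local Open Scope complex_scope.

Lemma cat_inj (T : eqType) (u : seq T) : injective (cat u).
Proof. by move=> w t /eqP; rewrite eqseq_cat // eqxx => /eqP. Qed.

Section RootedTree.
Variable d : nat.
Implicit Types (u v w : seq 'I_d) (x : 'I_d).

Definition tree_adj u v : bool :=
  [exists x, v == rcons u x] || [exists x, u == rcons v x].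

Definition tree_aut_pred (f : seq 'I_d -> seq 'I_d) : bool :=
  `[< [/\ bijective f, f [::] = [::] & {mono f : u v / tree_adj u v}] >].

Record tree_aut := TreeAut {
  tree_aut_fun :> seq 'I_d -> seq 'I_d ;
  tree_autP : tree_aut_pred tree_aut_fun }.

HB.instance Definition _ := [isSub for tree_aut_fun].
HB.instance Definition _ := [Choice of tree_aut by <:].

Implicit Types g h : tree_aut.

Lemma tree_aut_ext g h : g =1 h -> g = h.
Proof. by move=> gh; apply: val_inj; apply/funext. Qed.

Lemma tree_aut_bij g : bijective g.
Proof. by case/asboolP: (tree_autP g). Qed.

Lemma tree_aut_inj g : injective g.
Proof. exact: bij_inj (tree_aut_bij g). Qed.

Lemma tree_aut_root g : g [::] = [::].
Proof. by case/asboolP: (tree_autP g). Qed.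

Lemma tree_aut_adj g : {mono g : u v / tree_adj u v}.
Proof. by case/asboolP: (tree_autP g). Qed.

Lemma tree_aut_id_subproof : tree_aut_pred id.
Proof. by apply/asboolP; split=> //; exists id. Qed.
Definition tree_aut_id := TreeAut tree_aut_id_subproof.

Lemma tree_aut_comp_subproof g h : tree_aut_pred (g \o h).
Proof.
apply/asboolP; split.
- exact: bij_comp (tree_aut_bij g) (tree_aut_bij h).
- by rewrite /= !tree_aut_root.
- by move=> u v; rewrite /= !tree_aut_adj.
Qed.
Definition tree_aut_comp g h := TreeAut (tree_aut_comp_subproof g h).

Lemma tree_aut_surj g v : exists u, g u == v.
Proof. by case: (tree_aut_bij g) => k _ gK; exists (k v); rewrite gK. Qed.

Definition tree_aut_inv_fun g v := xchoose (tree_aut_surj g v).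

Lemma tree_aut_invK g : cancel (tree_aut_inv_fun g) g.
Proof. by move=> v; exact/eqP/(xchooseP (tree_aut_surj g v)). Qed.

Lemma tree_autK g : cancel g (tree_aut_inv_fun g).
Proof. by move=> v; apply: (tree_aut_inj (g := g)); rewrite tree_aut_invK. Qed.

Lemma tree_aut_inv_subproof g : tree_aut_pred (tree_aut_inv_fun g).
Proof.
apply/asboolP; split.
- by exists g; [exact: tree_aut_invK | exact: tree_autK].
- by apply: (tree_aut_inj (g := g)); rewrite tree_aut_invK tree_aut_root.
- by move=> u v; rewrite -(tree_aut_adj g) !tree_aut_invK.
Qed.
Definition tree_aut_inv g := TreeAut (tree_aut_inv_subproof g).

Lemma tree_aut_mulA : associative tree_aut_comp.
Proof. by move=> g h k; exact: tree_aut_ext. Qed.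
Lemma tree_aut_mul1 : left_id tree_aut_id tree_aut_comp.
Proof. by move=> g; exact: tree_aut_ext. Qed.
Lemma tree_aut_mulr1 : right_id tree_aut_id tree_aut_comp.
Proof. by move=> g; exact: tree_aut_ext. Qed.
Lemma tree_aut_mulV : left_inverse tree_aut_id tree_aut_inv tree_aut_comp.
Proof. by move=> g; apply: tree_aut_ext => v; exact: tree_autK. Qed.
Lemma tree_aut_mulrV : right_inverse tree_aut_id tree_aut_inv tree_aut_comp.
Proof. by move=> g; apply: tree_aut_ext => v; exact: tree_aut_invK. Qed.

HB.instance Definition _ := isGroup.Build tree_aut
  tree_aut_mulA tree_aut_mul1 tree_aut_mulr1 tree_aut_mulV tree_aut_mulrV.

Lemma tree_aut_Vg g v : (g^-1)%g (g v) = v.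
Proof. exact: tree_autK. Qed.

Lemma tree_adj_rcons v x : tree_adj v (rcons v x).
Proof. by apply/orP; left; apply/existsP; exists x. Qed.

Lemma tree_aut_rcons g v x : exists y, g (rcons v x) = rcons (g v) y.
Proof.
elim/last_ind: v x => [|v z IHv] x; have := tree_adj_rcons.
  move=> /(_ [::] x); rewrite -(tree_aut_adj g) tree_aut_root.
  case/orP=> /existsP[y /eqP e]; first by exists y.
  by move/(congr1 size): e; rewrite size_rcons.
move=> /(_ (rcons v z) x); rewrite -(tree_aut_adj g).
case/orP=> /existsP[y /eqP e]; first by exists y.
have [t gt] := IHv z; move: e; rewrite gt => /rcons_inj[gv _].
move/tree_aut_inj/(congr1 size): gv; rewrite !size_rcons => /eqP.
by rewrite -{1}[size v]addn0 -addn2 eqn_add2l.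
Qed.

Lemma size_tree_aut g v : size (g v) = size v.
Proof.
elim/last_ind: v => [|v x IHv]; first by rewrite tree_aut_root.
by have [y ->] := tree_aut_rcons g v x; rewrite !size_rcons IHv.
Qed.

(* The action on the subtree rooted at v, transported to the whole tree: it is
   the automorphism denoted phi_(g v) g by the defining equation section_eq. *)
Definition section_fun g v w := drop (size v) (g (v ++ w)).

Lemma section_funE g v w : g (v ++ w) = g v ++ section_fun g v w.
Proof.
suff [t gt] : exists t, g (v ++ w) = g v ++ t.
  by rewrite /section_fun gt -(size_tree_aut g v) drop_size_cat.
elim/last_ind: w => [|w x [t IH]]; first by exists [::]; rewrite !cats0.
have [y] := tree_aut_rcons g (v ++ w) x.
by rewrite IH !rcons_cat => ->; exists (rcons t y).
Qed.

Lemma tree_adj_cat v u w : tree_adj (v ++ u) (v ++ w) = tree_adj u w.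
Proof.
by rewrite /tree_adj; congr (_ || _); apply: eq_existsb => x;
  rewrite rcons_cat eqseq_cat // eqxx.
Qed.

Lemma section_subproof g v : tree_aut_pred (section_fun g v).
Proof.
apply/asboolP; split.
- have gVK : (g^-1)%g (g v) = v by exact: tree_autK.
  exists (section_fun (g^-1)%g (g v)) => w.
    have := section_funE (g^-1)%g (g v) (section_fun g v w).
    by rewrite gVK -section_funE [(g^-1)%g _]tree_autK => /cat_inj.
  have := section_funE g v (section_fun (g^-1)%g (g v) w).
  by rewrite -[X in g (X ++ _)]gVK -section_funE [g _]tree_aut_invK => /cat_inj.
- by apply: (@cat_inj _ (g v)); rewrite -section_funE !cats0.
- move=> u w.
  by rewrite -(tree_adj_cat (g v)) -!section_funE tree_aut_adj tree_adj_cat.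
Qed.
Definition section g v := TreeAut (section_subproof g v).

Lemma section_eq g v w : g (v ++ w) = g v ++ section g v w.
Proof. exact: section_funE. Qed.

Lemma sectionM g h v : section (g * h)%g v = (section g (h v) * section h v)%g.
Proof.
apply: tree_aut_ext => w; apply: (@cat_inj _ ((g * h)%g v)).
rewrite -section_eq; change ((g * h)%g (v ++ w)) with (g (h (v ++ w))).
by rewrite !section_eq.
Qed.

Lemma sectionV g v : section g^-1%g v = (section g (g^-1%g v))^-1%g.
Proof.
apply: (mulgI (section g (g^-1%g v))); rewrite mulgV -sectionM mulgV.
by apply: tree_aut_ext => w; apply: (@cat_inj _ v); rewrite -(section_eq 1%g).
Qed.

Lemma section_cat g u v : section g (u ++ v) = section (section g u) v.
Proof.
apply: tree_aut_ext => w; apply: (@cat_inj _ (g (u ++ v))).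
by rewrite -section_eq -catA !section_eq catA.
Qed.

(* phi_u(g), indexed by the vertex u = g v that is the image under g. *)
Definition phi u g : tree_aut := section g ((g^-1)%g u).

Lemma phiE g v w : g (v ++ w) = g v ++ phi (g v) g w.
Proof. by rewrite /phi [(g^-1)%g (g v)]tree_autK section_eq. Qed.

End RootedTree.

Section Subgroup.
Variables (gT : groupType) (G : groupClosed gT).

Definition subgroup_type := {x : gT | x \in G}.

HB.instance Definition _ := SubChoice.on subgroup_type.

Lemma subgroup_type_closed : group_closed [pred x | x \in G].
Proof. by split=> [|x y xG yG]; [exact: gpred1 | exact: gpredF]. Qed.

HB.instance Definition _ :=
  SubChoice_isSubGroup.Build gT _ subgroup_type subgroup_type_closed.

End Subgroup.

Section Automaton.
Variables (d : nat) (G : groupClosed (tree_aut d)).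

Definition generates (S : {fset tree_aut d}) : Prop :=
  {subset S <= G} /\
  forall H : {pred tree_aut d},
    group_closed H -> {subset S <= H} -> {subset G <= H}.

Definition generated_by_automaton : Prop :=
  exists2 S : {fset tree_aut d}, generates S &
    forall (v : 1.-tuple 'I_d) g, g \in S -> phi v g \in S.

Definition topologically_free : Prop :=
  forall (g : tree_aut d) (v : seq 'I_d), g \in G ->
    (forall w, g (v ++ w) = v ++ w) -> g = 1%g.

Definition generated_by_reversible_automaton : Prop :=
  generated_by_automaton /\ topologically_free.

(* phi_u as a map from G to G.  The default value is irrelevant when G is
   generated by an automaton, see val_phiG. *)
Definition phiG (u : seq 'I_d) (g : subgroup_type G) : subgroup_type G :=
  insubd 1%g (phi u (val g)).

Lemma automaton_section (g : tree_aut d) v :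
  generated_by_automaton -> g \in G -> section g v \in G.
Proof.
move=> [S [SG genS] autS]; pose K := [pred h | (h \in G) &&
  `[< forall x : 'I_d, section h [:: x] \in G >]].
have KG : {subset G <= K}.
  apply: genS => [|h hS].
    split=> [|h k].
      rewrite inE gpred1; apply/asboolP => x.
      suff -> : section 1%g [:: x] = 1%g :> tree_aut d by exact: gpred1.
      apply: tree_aut_ext => w; apply: (@cat_inj _ [:: x]).
      by rewrite -(section_eq 1%g).
    rewrite !inE => /andP[hG /asboolP hK] /andP[kG /asboolP kK].
    rewrite gpredF //; apply/asboolP => x; rewrite sectionM sectionV.
    have /eqP := size_tree_aut (k^-1)%g [:: x].
    case: ((k^-1)%g _) => [|y [|]] //= _.
    by rewrite gpredM // gpredV.
  rewrite inE SG //; apply/asboolP => x; apply: SG.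
  have szh : size (h [:: x]) == 1%N by rewrite size_tree_aut.
  have := autS (Tuple szh) h hS.
  by rewrite /phi (_ : (h^-1)%g (Tuple szh) = [:: x]) //; exact: tree_autK.
elim: v g => [|x v IHv] g gG.
  suff -> : section g [::] = g by [].
  by apply: tree_aut_ext => w; have := section_eq g [::] w; rewrite tree_aut_root.
have /andP[_ /asboolP gK] := KG g gG.
by rewrite -cat1s section_cat IHv.
Qed.

Lemma val_phiG u (g : subgroup_type G) :
  generated_by_automaton -> val (phiG u g) = phi u (val g).
Proof. by move=> autG; rewrite insubdK // automaton_section //; exact: valP. Qed.

End Automaton.

Section Ell2.
Variables (R : realType) (I : choiceType).
Local Notation C := R[i].
Local Notation normc := ComplexField.Normc.normc.

Definition sqsum (f : I -> C) : \bar R :=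
  \esum_(i in [set: I]) (normc (f i) ^+ 2)%:E.

Definition ell2_pred : {pred I -> C} := fun f => `[< (sqsum f < +oo)%E >].

Record ell2 := Ell2 { ell2_fun :> I -> C ; ell2P : ell2_fun \in ell2_pred }.

HB.instance Definition _ := [isSub for ell2_fun].
HB.instance Definition _ := [Choice of ell2 by <:].

Lemma ell2_predP (f : I -> C) :
  reflect (exists M : R, forall A : {fset I}, \sum_(i <- A) normc (f i) ^+ 2 <= M)
          (f \in ell2_pred).
Proof.
rewrite unfold_in; apply: (iffP (asboolP _)) => [foo|[M fM]].
  have f0 : (0 <= sqsum f)%E by apply: esum_ge0 => i _; rewrite lee_fin sqr_ge0.
  exists (fine (sqsum f)) => A.
  rewrite -lee_fin fineK; last by rewrite ge0_fin_numE.
  apply: esum_ge; exists [set` A]; first by split=> //; exact: finite_fset.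
  by rewrite fsbig_finite //= set_fsetK sumEFin.
apply: (@le_lt_trans _ _ M%:E); last exact: ltry.
apply: ge_ereal_sup => _ [A [finA _] <-].
by rewrite fsbig_finite //= sumEFin lee_fin.
Qed.

Lemma normc_sqrD (x y : C) :
  normc (x + y) ^+ 2 <= 2 * (normc x ^+ 2 + normc y ^+ 2).
Proof.
have sq (z : C) : normc z ^+ 2 = complex.Re z ^+ 2 + complex.Im z ^+ 2.
  by case: z => a b /=; rewrite sqr_sqrtr // addr_ge0 ?sqr_ge0.
rewrite !sq; case: x => a b; case: y => a' b' /=; rewrite -subr_ge0.
suff -> : 2 * (a ^+ 2 + b ^+ 2 + (a' ^+ 2 + b' ^+ 2)) -
    ((a + a') ^+ 2 + (b + b') ^+ 2) = (a - a') ^+ 2 + (b - b') ^+ 2.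
  by rewrite addr_ge0 ?sqr_ge0.
by rewrite !expr2; ring.
Qed.

Lemma ell2_submod_closed : submod_closed ell2_pred.
Proof.
split=> [|c f g /ell2_predP[M fM] /ell2_predP[N gN]]; apply/ell2_predP.
  exists 0 => A; rewrite big1 // => i _.
  by rewrite ComplexField.Normc.normc0 expr0n.
exists (2 * (normc c ^+ 2 * M + N)) => A.
have le_cfg i : normc ((c *: f + g) i) ^+ 2 <=
    2 * (normc c ^+ 2 * normc (f i) ^+ 2 + normc (g i) ^+ 2).
  apply: le_trans (normc_sqrD _ _) _.
  by rewrite ComplexField.Normc.normcM exprMn.
apply: le_trans (ler_sum _ (fun i _ => le_cfg i)) _.
rewrite -mulr_sumr big_split /= -mulr_sumr ler_wpM2l // lerD //.
by rewrite ler_wpM2l ?sqr_ge0.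
Qed.

HB.instance Definition _ := GRing.isSubmodClosed.Build _ _ ell2_pred
  ell2_submod_closed.
HB.instance Definition _ := [SubChoice_isSubLmodule of ell2 by <:].

Definition norm2 (f : ell2) : R := Num.sqrt (fine (sqsum f)).

(* The limit of the net of finite partial sums, which exists for all f and g by
   Cauchy-Schwarz. *)
Definition inner (f g : ell2) : C :=
  summability.sum (fun i => (f i * (g i)^*)%C : C^o).

End Ell2.

Section ReducedCstar.
Variables (R : realType) (G : groupType).
Local Notation C := R[i].
Local Notation H := (ell2 R G).
Local Notation op := (H -> H).

Definition group_algebra := {fsfun G -> C with 0}.

Lemma translate_subproof (g : G) (f : H) :
  (fun h => f (g^-1 * h)%g) \in @ell2_pred R G.
Proof.
apply/ell2_predP; have /ell2_predP[M fM] := ell2P f; exists M => A.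
have := fM [fset (g^-1 * h)%g | h in A]%fset.
by rewrite big_imfset //= => h k _ _; exact: mulgI.
Qed.

Definition left_translation (g : G) : op :=
  fun f => Ell2 (translate_subproof g f).

Definition left_regular (x : group_algebra) : op :=
  fun f => \sum_(g <- finsupp x) x g *: left_translation g f.

Definition bounded_op (T : op) : Prop :=
  exists M : R, forall f, norm2 (T f) <= M * norm2 f.

Definition opnorm (T : op) : R :=
  sup [set norm2 (T f) | f in [set f | norm2 f <= 1]].

Definition adjoint_op (T S : op) : Prop :=
  forall f g, inner (T f) g = inner f (S g).

Definition Cred : set op := [set T | [/\ linear T, bounded_op T &
  forall e : R, 0 < e ->
    exists x : group_algebra, opnorm (T - left_regular x) <= e]].

(* Square matrices of operators with index set J act on families J -> H, that
   is, on the Hilbert sum of J copies of H. *)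
Section Matrices.
Variable J : finType.
Local Notation mxop := (J -> J -> op).
Implicit Types A B : mxop.

Definition mxCred : set mxop := [set A | forall i j, Cred (A i j)].

Definition mxop_mul A B : mxop := fun i j => \sum_k (A i k \o B k j).

Definition mxop_app A (f : J -> H) : J -> H := fun i => \sum_j A i j (f j).

Definition vnorm2 (f : J -> H) : R := Num.sqrt (\sum_i norm2 (f i) ^+ 2).

Definition mxopnorm A : R :=
  sup [set vnorm2 (mxop_app A f) | f in [set f | vnorm2 f <= 1]].

Definition mxop_pos A : Prop :=
  forall f : J -> H, 0 <= \sum_i inner (mxop_app A f i) (f i).

End Matrices.

(* Phi stands for a map C*_red(G) -> M_J(C*_red(G)): its values on operators
   outside Cred are unconstrained.  Adjoints are relational since Riesz duality
   is not available. *)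
Record isometric_star_morphism (J : finType) (Phi : op -> J -> J -> op) : Prop :=
  IsometricStarMorphism {
    ism_fun : set_fun Cred (@mxCred J) Phi ;
    ism_linear : forall (c : C) a b, Cred a -> Cred b ->
      Phi (c *: a + b) = c *: Phi a + Phi b ;
    ism_mul : forall a b, Cred a -> Cred b ->
      Phi (a \o b) = mxop_mul (Phi a) (Phi b) ;
    ism_star : forall a b, Cred a -> Cred b -> adjoint_op a b ->
      forall i j, adjoint_op (Phi a i j) (Phi b j i) ;
    ism_norm : forall a, Cred a -> mxopnorm (Phi a) = opnorm a }.

(* M_k(M_J(C*_red(G))) is identified with the matrices indexed by 'I_k * J. *)
Definition flatten_mx (J : finType) k (A : 'I_k -> 'I_k -> J -> J -> op)
    (p q : 'I_k * J) : op :=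
  A p.1 q.1 p.2 q.2.

(* Completely positive contractive projections of M_J(C*_red(G)) onto B that are
   B-bimodule maps; as above, E only matters on mxCred. *)
Record conditional_expectation (J : finType) (B : set (J -> J -> op))
    (E : (J -> J -> op) -> J -> J -> op) : Prop :=
  ConditionalExpectation {
    ce_range : set_fun (@mxCred J) B E ;
    ce_proj : forall b, B b -> E b = b ;
    ce_linear : forall (c : C) A A', mxCred A -> mxCred A' ->
      E (c *: A + A') = c *: E A + E A' ;
    ce_contractive : forall A, mxCred A -> mxopnorm (E A) <= mxopnorm A ;
    ce_positive : forall k (A : 'I_k -> 'I_k -> J -> J -> op),
      (forall p q, mxCred (A p q)) -> mxop_pos (flatten_mx A) ->
      mxop_pos (flatten_mx (fun p q => E (A p q))) ;
    ce_mull : forall b A, B b -> mxCred A ->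
      E (mxop_mul b A) = mxop_mul b (E A) ;
    ce_mulr : forall A b, mxCred A -> B b ->
      E (mxop_mul A b) = mxop_mul (E A) b }.

End ReducedCstar.

Section Recursion.
Variables (R : realType) (d : nat) (G : groupClosed (tree_aut d)).
Local Notation GT := (subgroup_type G).
Local Notation op := (ell2 R GT -> ell2 R GT).
Local Notation L n := (n.-tuple 'I_d).

(* Linear extension to the group algebra of the map sending g to the matrix
   with (g v, v) entry phi_(g v) g and all other entries 0. *)
Definition recursion n (x : group_algebra R GT) (u v : L n) :
    group_algebra R GT :=
  [fsfun h in [fset phiG u g | g in finsupp x]%fset =>
    \sum_(g <- finsupp x | (val g v == u :> seq 'I_d) && (phiG u g == h)) x g
  | 0].

Definition extends_recursion (Phi : op -> L 1 -> L 1 -> op) : Prop :=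
  forall x u v, Phi (left_regular x) u v = left_regular (recursion x u v).

(* The n-fold iterate: Phi is applied to a, then the (n-1)-fold iterate to each
   entry.  The index of the outer block is the first letter of a word. *)
Fixpoint iter_recursion (Phi : op -> L 1 -> L 1 -> op) n (a : op) :
    L n -> L n -> op :=
  match n return L n -> L n -> op with
  | 0 => fun _ _ => a
  | m.+1 => fun u v =>
      iter_recursion Phi (Phi a [tuple thead u] [tuple thead v])
        [tuple of behead u] [tuple of behead v]
  end.

Lemma recursionE n (x : group_algebra R GT) (u v : L n) h :
  recursion x u v h =
  \sum_(g <- finsupp x | (val g v == u :> seq 'I_d) && (phiG u g == h)) x g.
Proof.
rewrite fsfunE; case: ifPn => // hA; rewrite big_seq_cond big1 // => g.
case/and3P=> gx _ /eqP gh; case/negP: hA.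
by rewrite -gh; apply/imfsetP; exists g.
Qed.

Lemma recursionS n (x : group_algebra R GT) (u v : L n.+1) :
  generated_by_automaton G ->
  recursion x u v =
  recursion (recursion x [tuple thead u] [tuple thead v])
    [tuple of behead u] [tuple of behead v].
Proof.
move=> autG; apply/fsfunP => h; rewrite !recursionE.
case/tupleP: u => a u; case/tupleP: v => b v; rewrite !theadE.
set y := recursion _ _ _.
set A := [fset phiG [tuple a] g | g in finsupp x]%fset.
pose Q (k : GT) := (val k v == u :> seq 'I_d) && (phiG u k == h).
have bE (w : L n) c : [tuple of behead [tuple of c :: w]] = w.
  exact: val_inj.
rewrite !bE -/(Q _).
transitivity (\sum_(k <- A | Q k) y k); last first.
  rewrite big_mkcond [RHS]big_mkcond; apply/esym/big_fset_incl => [|k _].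
    apply/fsubsetP => k; apply: contraLR => kA.
    rewrite memNfinsupp /y fsfunE; by rewrite (negbTE kA).
  by rewrite memNfinsupp => /eqP ->; rewrite if_same.
under [RHS]eq_bigr do rewrite recursionE.
rewrite [LHS]big_mkcond [LHS](partition_big_imfset _ (phiG [:: a])).
rewrite [RHS]big_mkcond; apply: eq_bigr => k _; rewrite -big_mkcondr /=.
have condE g : phiG [:: a] g = k ->
    (val g (b :: v) == a :: u) && (phiG (a :: u) g == h) =
    (val g [:: b] == [:: a]) && Q k.
  move=> gk; have gcat := section_eq (val g) [:: b] v.
  rewrite -cat1s gcat -[a :: u]cat1s eqseq_cat ?size_tree_aut // -andbA.
  have [gb|//] := eqVneq (val g [:: b]) [:: a]; rewrite /Q /=.
  have phib : val k = section (val g) [:: b].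
    by rewrite -gk val_phiG // /phi -gb tree_aut_Vg.
  rewrite -[section_fun _ _ _]/(section (val g) [:: b] v) -phib.
  have [kv|//] := eqVneq (val k v : seq 'I_d) u; congr (_ == h).
  apply: val_inj; rewrite !val_phiG //= -kv /phi tree_aut_Vg.
  have gbv : val g (b :: v) = a :: val k v by rewrite -cat1s gcat gb -phib.
  by rewrite -gbv tree_aut_Vg phib -section_cat.
case: ifPn => Qk.
  apply: eq_bigl => g; rewrite [RHS]andbC; have [/condE -> |//] := eqVneq.
  by rewrite Qk andbT.
rewrite big1 // => g /andP[/eqP/condE ->].
by rewrite (negbTE Qk) andbF.
Qed.

Lemma iter_recursion_left_regular Phi n (x : group_algebra R GT) (u v : L n) :
  generated_by_automaton G -> extends_recursion Phi ->
  iter_recursion Phi (left_regular x) u v = left_regular (recursion x u v).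
Proof.
move=> autG PhiE; elim: n x u v => [|n IHn] x u v /=; last first.
  by rewrite PhiE IHn [in RHS]recursionS.
congr left_regular; apply/fsfunP => h; rewrite recursionE (tuple0 u) (tuple0 v).
have phi0 (g : GT) : phiG [::] g = g.
  apply: val_inj; rewrite val_phiG //.
  rewrite /phi (_ : ((val g)^-1)%g [::] = [::]); last exact: tree_aut_root.
  apply: tree_aut_ext => w.
  by have := section_eq (val g) [::] w; rewrite tree_aut_root.
rewrite (eq_bigl (fun g => g == h)); last first.
  by move=> g /=; rewrite phi0 (tree_aut_root (val g)) eqxx.
rewrite big_mkcond /=; have [hx|hx] := boolP (h \in finsupp x).
  rewrite (big_fsetD1 h) //= eqxx big1_seq ?addr0 // => g.
  by rewrite !inE => /andP[_ /andP[/negbTE -> _]].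
rewrite big1_seq => [|g /andP[_ gx]]; first by rewrite fsfun_dflt.
by case: eqP hx => // <-; rewrite gx.
Qed.

End Recursion.

(* Main.v *)
(* The points [(v, h)] of [L n * G] form a G-set under
   [g (v, h) = (g v, section g v * h)], and topological freeness says exactly
   that this action is free.  Hence l2(L n * G) splits into copies of l2(G), one
   per orbit, and Phi^(n)(a) is the operator acting as [a] on each copy; this
   makes sense for every operator commuting with right translations and is
   visibly isometric.  Writing V_v for the isometry from l2(G) to l2(L n * G)
   induced by the orbit map of [(v, 1)], one has V_v^* Phi^(n)(a) = a V_v^* and
   Phi^(n)(a) V_v = V_v a, so A |-> d^-n sum_v V_v^* A V_v is a left inverse of
   Phi^(n), and following it by Phi^(n) gives the conditional expectation.  By
   freeness it sends a matrix unit times a group element to a multiple of a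
   group element or to 0, so that it takes values in C*_red(G). *)
Require Import Defs.
From mathcomp Require Import all_boot all_order all_algebra finmap.
From mathcomp Require Import complex.
From mathcomp Require Import all_classical all_reals all_analysis.
From mathcomp.analysis.showcase Require summability.
From mathcomp Require Import ring lra.
Set Implicit Arguments.
Unset Strict Implicit.
Unset Printing Implicit Defensive.
Import Order.TTheory GRing.Theory Num.Theory numFieldNormedType.Exports.
Local Open Scope classical_set_scope.
Local Open Scope ring_scope.
Local Open Scope complex_scope.

Local Notation normc := ComplexField.Normc.normc.
#[local] Existing Instance summability.totally_filter.

(** * Square-summable families *)

(** The averaging over [v] is forced by the codomain. Each single map A |-> V_v^* A V_v is already a
    contractive left inverse of Phi^(n) with the same bimodule property, but it sends the matrix
    unit at [(u, w)] times the translation by [h] to 0 or to a translation cut off by the indicator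
    of the set of [g] with [g v = u]. Unless that set is empty or all of G, the cut-off translation
    does not commute with right translations and so leaves C*_red(G). For given [g] exactly one [v]
    satisfies [g v = u], so summing over [v] removes the cutoff. Each copy of l2(G) is canonical
    only up to a right translation, since moving the base point along its orbit changes the orbit
    map by one. This is where commutation with right translations comes from. Phi^(n) is thereby
    defined at once on a von Neumann algebra containing C*_red(G), without extension by continuity
    from C G; approximation by C G serves to place C*_red(G) inside it and to check that values
    remain in C*_red(G). *)

Section Complex.
Variable R : realType.
Implicit Types z : R[i].

Lemma normc_sqr z : (normc z ^+ 2)%:C = z * z^*%C.
Proof. by rewrite -sqr_normc rmorphXn. Qed.

Lemma normc_ge0 z : 0 <= normc z.
Proof. by case: z => a b; exact: sqrtr_ge0. Qed.

End Complex.

Lemma big_fset_pick (V : nmodType) (I : choiceType) (A : {fset I}) (i : I)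
    (F : I -> V) : (forall j, j != i -> F j = 0) ->
  \sum_(j <- A) F j = if i \in A then F i else 0.
Proof.
move=> F0; case: ifPn => iA.
  rewrite (big_fsetD1 i) //= big1_seq ?addr0 // => j /andP[_].
  by rewrite !inE => /andP[/F0].
by rewrite big1_seq // => j /andP[_ jA]; apply: F0; apply: contraNneq iA => <-.
Qed.

Section Ell2Theory.
Variables (R : realType) (I : choiceType).
Local Notation C := R[i].
Implicit Types (f g h : ell2 R I) (A : {fset I}).

Lemma sqsum_ge0 (f : I -> C) : (0 <= sqsum f)%E.
Proof. by apply: esum_ge0 => i _; rewrite lee_fin sqr_ge0. Qed.

Lemma norm2_ge0 f : 0 <= norm2 f.
Proof. exact: sqrtr_ge0. Qed.

Lemma norm2_sqrE f : (norm2 f ^+ 2)%:E = sqsum f.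
Proof.
have f0 := sqsum_ge0 f; have foo : (sqsum f < +oo)%E by apply/asboolP/(ell2P f).
by rewrite sqr_sqrtr ?fine_ge0 // fineK // ge0_fin_numE.
Qed.

Lemma sum_le_norm2 f A : \sum_(i <- A) normc (f i) ^+ 2 <= norm2 f ^+ 2.
Proof.
rewrite -lee_fin norm2_sqrE -sumEFin.
apply: esum_ge; exists [set` A]; first by split=> //; exact: finite_fset.
by rewrite fsbig_finite //= set_fsetK.
Qed.

Lemma norm2_le f M : 0 <= M ->
  (forall A, \sum_(i <- A) normc (f i) ^+ 2 <= M ^+ 2) -> norm2 f <= M.
Proof.
move=> M0 fM; rewrite -[_ <= _]ler_sqr ?nnegrE ?norm2_ge0 // -lee_fin norm2_sqrE.
apply: ge_ereal_sup => _ [A [finA _] <-].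
by rewrite fsbig_finite //= sumEFin lee_fin.
Qed.

Lemma sum_near_norm2 f e : 0 < e ->
  exists A, norm2 f ^+ 2 - e < \sum_(i <- A) normc (f i) ^+ 2.
Proof.
move=> e0; apply: contrapT => /forallNP noA.
suff: norm2 f ^+ 2 <= norm2 f ^+ 2 - e by rewrite lerBrDl gerDr leNgt e0.
rewrite -lee_fin {1}norm2_sqrE; apply: ge_ereal_sup => _ [A [finA _] <-].
by rewrite fsbig_finite //= sumEFin lee_fin leNgt; apply/negP/noA.
Qed.

Lemma norm2_sqr_cvg f :
  summability.partial_sum (fun i => (normc (f i) ^+ 2)%:C : C^o)
    @ summability.totally --> ((norm2 f ^+ 2)%:C : C^o).
Proof.
apply/cvgrPdist_lt => e e0.
have [r er] : exists r : R, e = r%:C.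
  by apply/complex_realP; rewrite gtr0_real.
have r0 : 0 < r by rewrite -ltcR -er.
have [A fA] := sum_near_norm2 f r0.
exists A => // B /= AB.
rewrite /summability.partial_sum -rmorph_sum -rmorphB /= er.
rewrite -(big_seq_fsetE _ _ predT (fun i => normc (f i) ^+ 2)) /=.
set s := \sum_(i <- B) _.
have sle : s <= norm2 f ^+ 2 by exact: sum_le_norm2.
have les : \sum_(i <- A) normc (f i) ^+ 2 <= s.
  rewrite /s [leRHS](big_fsetID _ (mem A)) /=.
  have -> : [fset x in B | x \in A]%fset = A.
    apply/fsetP => x; rewrite !inE andbC /=; case xA: (x \in A) => //=.
    exact: (fsubsetP AB).
  by rewrite lerDl sumr_ge0 // => i _; exact: sqr_ge0.
have le0 : 0 <= (norm2 f ^+ 2 - s)%:C :> C by rewrite ler0c subr_ge0.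
by rewrite (ger0_norm le0) ltcR; lra.
Qed.

Let polar f g : C :=
  4^-1 * ((norm2 (f + g) ^+ 2)%:C - (norm2 (f - g) ^+ 2)%:C
  + 'i * (norm2 (f + 'i *: g) ^+ 2)%:C - 'i * (norm2 (f - 'i *: g) ^+ 2)%:C).

Lemma polarization_scalar (x y : C) : x * y^*%C = 4^-1 *
  ((normc (x + y) ^+ 2)%:C - (normc (x - y) ^+ 2)%:C
  + 'i * (normc (x + 'i * y) ^+ 2)%:C - 'i * (normc (x - 'i * y) ^+ 2)%:C).
Proof.
have cD (a b : C) : (a + b)^*%C = a^*%C + b^*%C := rmorphD _ a b.
have cN (a : C) : (- a)^*%C = - a^*%C := rmorphN _ a.
have cM (a b : C) : (a * b)^*%C = a^*%C * b^*%C := rmorphM _ a b.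
have ci : 'i^*%C = - 'i :> C by rewrite /= /GRing.opp /= oppr0.
rewrite !normc_sqr !(cD, cN, cM) ci.
have i2 : 'i * 'i = -1 :> C by rewrite -expr2 sqr_i.
(* Keeping ['i * 'i] as a visible factor lets [ring] prove the expansion before this square is
   replaced by -1; [a] stands for the conjugate of [y]. *)
have -> (a : C) : 'i * ((x + 'i * y) * (x^*%C + - 'i * a)) =
   'i * x * x^*%C - ('i * 'i) * x * a + ('i * 'i) * y * x^*%C
   - ('i * 'i) * 'i * y * a by ring.
have -> (a : C) : 'i * ((x - 'i * y) * (x^*%C - - 'i * a)) =
   'i * x * x^*%C + ('i * 'i) * x * a - ('i * 'i) * y * x^*%C
   - ('i * 'i) * 'i * y * a by ring.
by rewrite i2; field.
Qed.

(** Termwise polarization turns the partial sums into a combination of four nets of squared norms,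
    which converge because [ell2] is closed under linear combinations. *)
Lemma inner_cvg f g :
  summability.partial_sum (fun i => (f i * (g i)^*%C)%C : C^o)
    @ summability.totally --> (inner f g : C^o).
Proof.
have cv : summability.partial_sum (fun i => (f i * (g i)^*%C)%C : C^o)
    @ summability.totally --> (polar f g : C^o).
  have -> : summability.partial_sum (fun i => (f i * (g i)^*%C)%C : C^o) =
    fun A => (4^-1 : C) * (
      summability.partial_sum (fun i => (normc ((f + g) i) ^+ 2)%:C : C^o) A
    - summability.partial_sum (fun i => (normc ((f - g) i) ^+ 2)%:C : C^o) A
    + 'i * summability.partial_sum (fun i => (normc ((f + 'i *: g) i) ^+ 2)%:C : C^o) A
    - 'i * summability.partial_sum (fun i => (normc ((f - 'i *: g) i) ^+ 2)%:C : C^o) A).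
    apply/funext => A; rewrite /summability.partial_sum.
    rewrite !mulr_sumr -!(sumrB, big_split) /= mulr_sumr.
    by apply: eq_bigr => i _; exact: polarization_scalar.
  apply: cvgMl_tmp.
  apply: cvgB; last by apply: cvgMl_tmp; exact: norm2_sqr_cvg.
  apply: cvgD; last by apply: cvgMl_tmp; exact: norm2_sqr_cvg.
  by apply: cvgB; exact: norm2_sqr_cvg.
by rewrite /inner /summability.sum; apply/cvg_ex; exists (polar f g).
Qed.

Lemma inner_unique f g (l : C) :
  summability.partial_sum (fun i => (f i * (g i)^*%C)%C : C^o)
    @ summability.totally --> (l : C^o) -> inner f g = l.
Proof.
move=> fgl; rewrite /inner /summability.sum; apply: cvg_lim fgl.
exact: norm_hausdorff.
Qed.

Lemma inner_linearl c f g h :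
  inner (c *: f + g) h = c * inner f h + inner g h.
Proof.
apply: inner_unique.
have -> : summability.partial_sum (fun i => ((c *: f + g) i * (h i)^*%C)%C : C^o) =
  fun A => c * summability.partial_sum (fun i => (f i * (h i)^*%C)%C : C^o) A +
    summability.partial_sum (fun i => (g i * (h i)^*%C)%C : C^o) A.
  apply/funext => A; rewrite /summability.partial_sum mulr_sumr -big_split /=.
  by apply: eq_bigr => i _; rewrite mulrA -mulrDl.
by apply: cvgD; [apply: cvgMl_tmp |]; exact: inner_cvg.
Qed.

Lemma innerC f g : inner g f = (inner f g)^*%C.
Proof.
apply: inner_unique; apply/cvgrPdist_lt => e e0.
have /cvgrPdist_lt/(_ e e0) := @inner_cvg f g; apply: filterS => A /=.
rewrite -normcJ rmorphB /summability.partial_sum rmorph_sum /=.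
by under eq_bigr do rewrite rmorphM /= conjcK mulrC.
Qed.

Lemma inner_self f : inner f f = (norm2 f ^+ 2)%:C.
Proof.
apply: inner_unique.
have -> : (fun i => (f i * (f i)^*%C)%C : C^o) = fun i => (normc (f i) ^+ 2)%:C.
  by apply/funext => i; rewrite normc_sqr.
exact: norm2_sqr_cvg.
Qed.

Lemma inner0l f : inner 0 f = 0.
Proof.
by have := inner_linearl (-1) f f f; rewrite scaleN1r addNr mulN1r addNr.
Qed.

Lemma innerDl f g h : inner (f + g) h = inner f h + inner g h.
Proof. by rewrite -[f]scale1r inner_linearl scale1r mul1r. Qed.

Lemma innerZl c f g : inner (c *: f) g = c * inner f g.
Proof. by rewrite -[_ *: _]addr0 inner_linearl inner0l addr0. Qed.

Lemma innerNl f g : inner (- f) g = - inner f g.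
Proof. by rewrite -scaleN1r innerZl mulN1r. Qed.

Lemma innerBl f g h : inner (f - g) h = inner f h - inner g h.
Proof. by rewrite innerDl innerNl. Qed.

Lemma inner0r f : inner f 0 = 0.
Proof. by rewrite innerC inner0l rmorph0. Qed.

Lemma innerDr f g h : inner h (f + g) = inner h f + inner h g.
Proof. by rewrite innerC innerDl rmorphD /= -!innerC. Qed.

Lemma innerZr c f g : inner g (c *: f) = c^*%C * inner g f.
Proof. by rewrite innerC innerZl rmorphM /= -!innerC. Qed.

Lemma innerBr f g h : inner h (f - g) = inner h f - inner h g.
Proof. by rewrite innerC innerBl rmorphB /= -!innerC. Qed.

Lemma inner_suml (J : Type) (r : seq J) (P : pred J) (F : J -> ell2 R I) g :
  inner (\sum_(j <- r | P j) F j) g = \sum_(j <- r | P j) inner (F j) g.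
Proof.
by apply: (big_morph (fun f => inner f g)) => [f h|]; rewrite ?innerDl ?inner0l.
Qed.

Lemma inner_sumr (J : Type) (r : seq J) (P : pred J) (F : J -> ell2 R I) g :
  inner g (\sum_(j <- r | P j) F j) = \sum_(j <- r | P j) inner g (F j).
Proof.
by apply: (big_morph (fun f => inner g f)) => [f h|]; rewrite ?innerDr ?inner0r.
Qed.

Lemma normc_le_norm2 f i : normc (f i) <= norm2 f.
Proof.
rewrite -[_ <= _]ler_sqr ?nnegrE ?norm2_ge0 ?normc_ge0 //.
by have := sum_le_norm2 f [fset i]%fset; rewrite big_seq_fset1.
Qed.

Lemma norm2_eq0 f : norm2 f = 0 -> f = 0.
Proof.
move=> f0; apply: val_inj; apply/funext => i; apply: ComplexField.Normc.eq0_normc.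
by apply/eqP; rewrite eq_le normc_ge0 -f0 normc_le_norm2.
Qed.

Lemma norm2_0 : norm2 (0 : ell2 R I) = 0.
Proof.
by apply/eqP; rewrite -sqrf_eq0 -(inj_eq (@complexI R)) -inner_self inner0l.
Qed.

Lemma norm2Z c f : norm2 (c *: f) = normc c * norm2 f.
Proof.
apply/eqP; rewrite -(@eqrXn2 _ 2) ?mulr_ge0 ?norm2_ge0 ?normc_ge0 //.
rewrite -(inj_eq (@complexI R)) -inner_self innerZl innerZr inner_self exprMn.
by rewrite mulrA -normc_sqr -rmorphM.
Qed.

Lemma norm2N f : norm2 (- f) = norm2 f.
Proof.
by rewrite -scaleN1r norm2Z normcN ComplexField.Normc.normc1 mul1r.
Qed.

Lemma cauchy_schwarz f g : normc (inner f g) <= norm2 f * norm2 g.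
Proof.
have [/norm2_eq0 ->|g0] := eqVneq (norm2 g) 0.
  by rewrite inner0r ComplexField.Normc.normc0 mulr_ge0 ?norm2_ge0.
rewrite -[_ <= _]ler_sqr ?nnegrE ?mulr_ge0 ?norm2_ge0 ?normc_ge0 //.
(* This is [norm2 g ^+ 2] times the component of [f] orthogonal to [g]. With denominators cleared,
   its squared norm is [b ^+ 2] times the difference that has to be nonnegative. *)
pose h := (norm2 g ^+ 2)%:C *: f - inner f g *: g.
have := sqr_ge0 (norm2 h); rewrite -ler0c -inner_self /h.
rewrite innerBl !innerBr !innerZl !innerZr !inner_self (innerC f g).
rewrite conjc_real [_^*%C * inner f g]mulrC -normc_sqr.
rewrite -!rmorphM /=.
set a := norm2 f; set b := norm2 g; set s := normc _.
have -> : inner f g * ((b ^+ 2)%:C * (inner f g)^*%C) = (b ^+ 2 * s ^+ 2)%:C.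
  by rewrite mulrCA -normc_sqr -rmorphM.
have -> : inner f g * ((inner f g)^*%C * (b ^+ 2)%:C) = (b ^+ 2 * s ^+ 2)%:C.
  by rewrite mulrA -normc_sqr -rmorphM mulrC.
rewrite -!rmorphB ler0c /= subrr subr0.
have b2 : 0 < b ^+ 2 by rewrite exprn_even_gt0.
by rewrite -mulrBr pmulr_rge0 // subr_ge0 exprMn mulrC.
Qed.

Lemma norm2D f g : norm2 (f + g) <= norm2 f + norm2 g.
Proof.
rewrite -[_ <= _]ler_sqr ?nnegrE ?addr_ge0 ?norm2_ge0 //.
rewrite -lecR -inner_self innerDl !innerDr !inner_self (innerC f g).
rewrite -addrA [inner f g + _]addrA addcJ sqrrD.
have -> : 2%:R * (complex.Re (inner f g))%:C =
    (2 * complex.Re (inner f g))%:C :> C by rewrite rmorphM /= rmorph_nat.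
rewrite -!rmorphD lecR /= -addrA lerD2l lerD2r mulr_natl ler_pMn2r //.
apply: le_trans (cauchy_schwarz f g).
by apply: le_trans (ler_norm _) _; rewrite -lecR; exact: normc_ge_Re.
Qed.

Lemma norm2_sum (J : Type) (r : seq J) (P : pred J) (F : J -> ell2 R I) :
  norm2 (\sum_(j <- r | P j) F j) <= \sum_(j <- r | P j) norm2 (F j).
Proof.
elim/big_ind2: _ => [|x1 x2 y1 y2 hx hy|//]; first by rewrite norm2_0.
by apply: le_trans (norm2D _ _) _; exact: lerD.
Qed.

Lemma delta_subproof i : (fun j => (j == i)%:R : C) \in @ell2_pred R I.
Proof.
apply/ell2_predP; exists 1 => A.
have d0 j : j != i -> normc ((j == i)%:R : C) ^+ 2 = 0.
  by move=> /negbTE ->; rewrite [normc _]ComplexField.Normc.normc0 expr0n.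
rewrite (big_fset_pick _ d0) eqxx [normc _]ComplexField.Normc.normc1 expr1n.
by case: ifP.
Qed.

Definition delta i : ell2 R I := Ell2 (delta_subproof i).

Lemma deltaE i j : delta i j = (j == i)%:R. Proof. by []. Qed.

Lemma inner_delta f i : inner f (delta i) = f i.
Proof.
apply: inner_unique; apply: cvg_near_cst.
exists [fset i]%fset => // A /= iA.
apply/eqP; rewrite /summability.partial_sum.
have iA' : i \in A by rewrite -fsub1set.
rewrite -(big_seq_fsetE _ _ predT (fun j => f j * (delta i j)^*%C)) /=.
rewrite (@big_fset_pick _ _ _ i) ?iA' ?deltaE ?eqxx ?rmorph1 ?mulr1 // => j ji.
by rewrite (negbTE ji) rmorph0 mulr0.
Qed.

Lemma ell2_ext f g : f =1 g -> f = g.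
Proof. by move=> fg; apply: val_inj; apply/funext. Qed.

Lemma ell2D f g i : (f + g) i = f i + g i. Proof. by []. Qed.
Lemma ell2N f i : (- f) i = - f i. Proof. by []. Qed.
Lemma ell2Z c f i : (c *: f) i = c * f i. Proof. by []. Qed.
Lemma ell2_sum (J : Type) (r : seq J) (P : pred J) (F : J -> ell2 R I) i :
  (\sum_(j <- r | P j) F j) i = \sum_(j <- r | P j) F j i.
Proof. by apply: (big_morph (fun f : ell2 R I => f i)). Qed.

(** The truncation [p] satisfies [inner f p = inner p p = s], so the squared error is
    [norm2 f ^+ 2 - s]. *)
Lemma ell2_dense f e : 0 < e ->
  exists A, norm2 (f - \sum_(i <- A) f i *: delta i) <= e.
Proof.
move=> e0; have [A fA] := sum_near_norm2 f (exprn_gt0 2 e0); exists A.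
rewrite -[_ <= _]ler_sqr ?nnegrE ?norm2_ge0 ?(ltW e0) // -lecR -inner_self.
set p := \sum_(i <- A) _.
set s := \sum_(i <- A) _ in fA.
have fp : inner f p = s%:C.
  rewrite inner_sumr rmorph_sum; apply: eq_bigr => i _.
  by rewrite innerZr inner_delta mulrC -normc_sqr.
have pp : inner p p = s%:C.
  rewrite {2}/p inner_sumr rmorph_sum big_seq [RHS]big_seq.
  apply: eq_bigr => i iA; rewrite innerZr inner_delta /p ell2_sum.
  rewrite (@big_fset_pick _ _ _ i) => [|j ji].
    by rewrite iA ell2Z deltaE eqxx mulr1 mulrC -normc_sqr.
  by rewrite ell2Z deltaE eq_sym (negbTE ji) mulr0.
rewrite innerBl !innerBr (innerC f p) pp fp conjc_real subrr subr0 inner_self.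
by rewrite -rmorphB lecR /=; lra.
Qed.

(** Density as an induction principle: adding multiples of basis vectors reaches the finitely
    supported families, and the closure premise reaches the rest. *)
Lemma ell2_ind (P : set (ell2 R I)) :
  P 0 -> (forall c i f, P f -> P (f + c *: delta i)) ->
  (forall f, (forall e, 0 < e -> exists2 g, P g & norm2 (f - g) <= e) -> P f) ->
  forall f, P f.
Proof.
move=> P0 PD Pcl f; apply: Pcl => e e0.
have [A fA] := ell2_dense f e0; exists (\sum_(i <- A) f i *: delta i) => //.
by elim/big_rec: _ => // i g _ Pg; rewrite addrC; exact: PD.
Qed.

Lemma complex_small0 (z : C) (M : R) :
  (forall e, 0 < e -> normc z <= M * e) -> z = 0.
Proof.
move=> zM; apply: ComplexField.Normc.eq0_normc; apply/eqP.
rewrite eq_le normc_ge0 andbT; apply/ler_addgt0Pr => e e0; rewrite add0r.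
have M1 : 0 < `|M| + 1 by rewrite ltr_wpDl.
apply: le_trans (zM (e / (`|M| + 1)) _) _; first by rewrite divr_gt0.
rewrite mulrA ler_pdivrMr // mulrC ler_wpM2l ?ltW //.
by apply: le_lt_trans (ler_norm _) _; rewrite ltrDl.
Qed.

End Ell2Theory.

Arguments delta {R I} i.

(** * Operators attached to a free action *)

Section LinearMaps.
Variables (K : pzRingType) (U V : lmodType K) (T : U -> V).
Hypothesis linT : linear T.

Lemma linmapD u v : T (u + v) = T u + T v.
Proof. by rewrite -[u]scale1r linT scale1r scale1r. Qed.

Lemma linmap0 : T 0 = 0.
Proof. by apply: (addrI (T 0)); rewrite -linmapD !addr0. Qed.

Lemma linmapZ c u : T (c *: u) = c *: T u.
Proof. by rewrite -[c *: u]addr0 linT linmap0 addr0. Qed.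

Lemma linmapB u v : T (u - v) = T u - T v.
Proof. by rewrite linmapD -scaleN1r linmapZ scaleN1r. Qed.

Lemma linmap_sum (J : Type) (r : seq J) (P : pred J) (F : J -> U) :
  T (\sum_(j <- r | P j) F j) = \sum_(j <- r | P j) T (F j).
Proof. exact: (big_morph T linmapD linmap0). Qed.

End LinearMaps.

Lemma normc_sum (R : realType) (J : Type) (r : seq J) (P : pred J) (z : J -> R[i]) :
  normc (\sum_(j <- r | P j) z j) <= \sum_(j <- r | P j) normc (z j).
Proof.
elim/big_ind2: _ => [|x1 x2 y1 y2 hx hy|//]; first by rewrite ComplexField.Normc.normc0.
by apply: le_trans (le_normcD _ _) _; exact: lerD.
Qed.

(** * Pullback and extension by zero along an injection of index sets *)

Section Injections.
Variables (R : realType) (I J : choiceType) (p : I -> J).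
Hypothesis injp : injective p.
Local Notation C := R[i].
Implicit Types (f : ell2 R I) (g : ell2 R J).

Lemma restrict_subproof g : (fun i => g (p i)) \in @ell2_pred R I.
Proof.
apply/ell2_predP; exists (norm2 g ^+ 2) => A.
have := sum_le_norm2 g [fset p i | i in A]%fset.
by rewrite big_imfset //= => i j _ _; exact: injp.
Qed.

(** Translations, orbit maps and matrix blocks all arise this way from some injection [p]; the
    adjoint is [ell2_extend], see [inner_restrict]. *)
Definition ell2_restrict g : ell2 R I := Ell2 (restrict_subproof g).

Lemma norm2_restrict g : norm2 (ell2_restrict g) <= norm2 g.
Proof.
apply: norm2_le => [|A]; first exact: norm2_ge0.
have := sum_le_norm2 g [fset p i | i in A]%fset.
by rewrite big_imfset //= => i j _ _; exact: injp.
Qed.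

Lemma restrict_linear : linear ell2_restrict.
Proof. by move=> c f g; exact: ell2_ext. Qed.

Definition extend_fun (f : I -> C) (j : J) : C :=
  if pselect (exists i, p i = j) is left e then f (projT1 (cid e)) else 0.

Lemma extend_fun_im f i : extend_fun f (p i) = f i.
Proof.
rewrite /extend_fun; case: pselect => [e|[]]; last by exists i.
by congr (f _); apply: injp; exact: projT2 (cid e).
Qed.

Lemma extend_fun_out f j : (forall i, p i <> j) -> extend_fun f j = 0.
Proof. by move=> nj; rewrite /extend_fun; case: pselect => // -[i ij]; case: (nj i). Qed.

Lemma sqsum_extend f : sqsum (extend_fun f) = sqsum f.
Proof.
rewrite /sqsum.
transitivity (\esum_(j in range p) (normc (extend_fun f j) ^+ 2)%:E)%E.
  rewrite [RHS]esum_mkcond; apply: eq_esum => j _.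
  case: ifPn => //; rewrite notin_setE => nj; rewrite extend_fun_out.
    by rewrite ComplexField.Normc.normc0 expr0n.
  by move=> i ij; apply: nj; exists i.
rewrite esum_image; last by move=> i j _ _; exact: injp.
by apply: eq_esum => i _; rewrite extend_fun_im.
Qed.

Lemma extend_subproof f : extend_fun f \in @ell2_pred R J.
Proof. by apply/asboolP; rewrite sqsum_extend; exact/asboolP/(ell2P f). Qed.

Definition ell2_extend f : ell2 R J := Ell2 (extend_subproof f).

Lemma extend_im f i : ell2_extend f (p i) = f i.
Proof. exact: extend_fun_im. Qed.

Lemma extend_out f j : (forall i, p i <> j) -> ell2_extend f j = 0.
Proof. exact: extend_fun_out. Qed.

Lemma norm2_extend f : norm2 (ell2_extend f) = norm2 f.
Proof. by rewrite /norm2 sqsum_extend. Qed.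

Lemma extendK : cancel ell2_extend ell2_restrict.
Proof. by move=> f; apply: ell2_ext => i; exact: extend_im. Qed.

Lemma extend_linear : linear ell2_extend.
Proof.
move=> c f g; apply: ell2_ext => j; rewrite ell2D ell2Z.
have [[i <-]|nj] := pselect (exists i, p i = j); first by rewrite !extend_im.
by rewrite !extend_out ?mulr0 ?addr0 // => i ij; apply: nj; exists i.
Qed.

Lemma extend_delta i : ell2_extend (delta i) = delta (p i).
Proof.
apply: ell2_ext => j; rewrite deltaE.
have [[k <-]|nj] := pselect (exists k, p k = j).
  by rewrite extend_im deltaE (inj_eq injp).
rewrite extend_out; first by case: eqP => // ij; case: nj; exists i.
by move=> k kj; apply: nj; exists k.
Qed.

End Injections.

(** * Identities and positivity obtained by density *)

Section Continuity.
Variables (R : realType) (I : choiceType).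
Local Notation C := R[i].
Implicit Types f g : ell2 R I.

(** Meant for [inner] as a function of its second argument, hence antilinear; boundedness carries
    the vanishing from finite combinations to limits. *)
Lemma antilinear_eq0 (L : ell2 R I -> C) (M : R) :
  (forall f g, L (f + g) = L f + L g) ->
  (forall c f, L (c *: f) = c^*%C * L f) ->
  (forall f, normc (L f) <= M * norm2 f) ->
  (forall i, L (delta i) = 0) -> forall f, L f = 0.
Proof.
move=> LD LZ LM L0 f; apply: (@ell2_ind _ _ (fun f => L f = 0)).
2: move=> c i {}f Lf.
3: move=> {}f Lf.
- by rewrite -[0](scale0r 0) LZ rmorph0 mul0r.
- by rewrite LD LZ L0 Lf mulr0 addr0.
apply: (@complex_small0 _ _ `|M|) => e /Lf[g Lg fg].
have -> : L f = L (f - g) by rewrite LD -scaleN1r LZ Lg mulr0 addr0.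
apply: le_trans (LM _) _; apply: (@le_trans _ _ (`|M| * norm2 (f - g))).
  by rewrite ler_wpM2r ?norm2_ge0 ?ler_norm.
by rewrite ler_wpM2l.
Qed.

(** Testing only [e <= 1] allows an error with a term quadratic in [e] to be bounded by a multiple
    of [e]. *)
Lemma complex_near_ge0 (z : C) (M : R) : 0 <= M ->
  (forall e, 0 < e <= 1 -> exists2 w : C, 0 <= w & normc (z - w) <= M * e) ->
  0 <= z.
Proof.
move=> M0 zM; have M1 : 0 < M + 1 by rewrite ltr_wpDl.
have near e : 0 < e -> exists2 w : C, 0 <= w & normc (z - w) <= e.
  move=> e0; pose e' := Num.min 1 (e / (M + 1)).
  have [|w w0 zw] := zM e'; first by rewrite lt_min ltr01 divr_gt0 //= ge_min lexx.
  exists w => //; apply: le_trans zw _.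
  apply: (@le_trans _ _ ((M + 1) * (e / (M + 1)))).
    apply: ler_pM => //; first by rewrite le_min ler01 divr_ge0 // ltW.
      by rewrite lerDl.
    by rewrite ge_min lexx orbT.
  by rewrite mulrCA divff ?mulr1 // gt_eqF.
have bnd (a b : C) : `|complex.Re (a - b)| <= normc (a - b) /\
    `|complex.Im (a - b)| <= normc (a - b).
  case: (a - b) => x y /=; split; rewrite -sqrtr_sqr ler_wsqrtr //.
    by rewrite lerDl sqr_ge0.
  by rewrite lerDr sqr_ge0.
have ReB (a b : C) : complex.Re (a - b) = complex.Re a - complex.Re b.
  by case: a b => ? ? [].
have ImB (a b : C) : complex.Im (a - b) = complex.Im a - complex.Im b.
  by case: a b => ? ? [].
rewrite lecE /=; apply/andP; split.
  rewrite -normr_le0; apply/ler_addgt0Pr => e /near[w w0 zw].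
  have [_] := bnd z w; rewrite ImB (ger0_Im w0) subr0 add0r => h.
  exact: le_trans h zw.
apply/ler_addgt0Pr => e /near[w w0 zw].
have [h1 _] := bnd z w; have := w0; rewrite lecE => /andP[_ /= w0'].
by move: h1 zw; rewrite ReB ler_norml => /andP[h1 _] zw; lra.
Qed.

(** Here [f] is a given candidate for the adjoint of [T] at [g]. Both sides are bounded and
    antilinear in [h], so testing on basis vectors suffices, and no Riesz representation is
    involved. *)
Lemma inner_adjoint (J : choiceType) (T : ell2 R I -> ell2 R J) (M : R)
    (f : ell2 R I) (g : ell2 R J) :
  linear T -> (forall h, norm2 (T h) <= M * norm2 h) ->
  (forall i, f i = inner g (T (delta i))) ->
  forall h, inner f h = inner g (T h).
Proof.
move=> linT TM fg h; apply/eqP; rewrite -subr_eq0; apply/eqP; move: h.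
apply: (@antilinear_eq0 _ (norm2 f + norm2 g * M)) => [h k|c h|h|i].
- by rewrite innerDr (linmapD linT) innerDr; ring.
- by rewrite (linmapZ linT) !innerZr mulrBr.
- apply: le_trans (le_normcD _ _) _; rewrite mulrDl.
  apply: lerD; first exact: cauchy_schwarz.
  rewrite normcN; apply: le_trans (cauchy_schwarz _ _) _.
  by rewrite -mulrA ler_wpM2l ?norm2_ge0.
- by rewrite inner_delta fg subrr.
Qed.

Lemma inner_restrict (J : choiceType) (p : I -> J) (injp : injective p)
    (g : ell2 R J) f :
  inner (ell2_restrict injp g) f = inner g (ell2_extend injp f).
Proof.
apply: (@inner_adjoint _ _ 1) => [|h|i]; first exact: extend_linear.
  by rewrite mul1r norm2_extend.
by rewrite extend_delta inner_delta.
Qed.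

End Continuity.

(** * Amplification of right-invariant operators along a free action *)

Section FreeAction.
Variables (R : realType) (G : groupType) (X : choiceType) (act : G -> X -> X).
Hypothesis act1 : forall x, act 1%g x = x.
Hypothesis actM : forall g h x, act (g * h)%g x = act g (act h x).
Hypothesis act_free : forall g x, act g x = x -> g = 1%g.
Local Notation C := R[i].
Local Notation op := (ell2 R G -> ell2 R G).
Implicit Types (a b : op) (f : ell2 R G) (F : ell2 R X).

(** Freeness in the form used below: orbit maps are injective, so that [push x] is an isometry. *)
Lemma act_inj x : injective (act^~ x).
Proof.
move=> g h gh; apply: (mulgI h^-1%g); rewrite mulVg.
by apply: (@act_free _ x); rewrite actM gh -actM mulVg act1.
Qed.

Definition pull x : ell2 R X -> ell2 R G := ell2_restrict (@act_inj x).
Definition push x : ell2 R G -> ell2 R X := ell2_extend (@act_inj x).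

Definition rtrans (k : G) : op := ell2_restrict (@mulIg G k).

(** These operators form the left group von Neumann algebra; it contains [Cred] by [Cred_rinv]. *)
Record right_invariant a : Prop := RightInvariant {
  rinv_linear : linear a;
  rinv_bounded : exists2 M, 0 <= M & forall f, norm2 (a f) <= M * norm2 f;
  rinv_comm : forall k f, a (rtrans k f) = rtrans k (a f) }.

Lemma pull_act k x F : pull (act k x) F = rtrans k (pull x F).
Proof. by apply: ell2_ext => g; rewrite /= actM. Qed.

(** Once the default point satisfies the predicate, [choose] depends on the predicate alone, and the
    points of one orbit give the same predicate; hence [orbit_rep] is constant on orbits. *)
Definition orbit_rep x := choose (fun y => `[< exists g, act g x = y >]) x.

Lemma orbit_repP x : exists g, act g x = orbit_rep x.
Proof.
apply/asboolP; apply: (@chooseP _ (fun y => `[< exists g, act g x = y >])).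
by apply/asboolP; exists 1%g.
Qed.

Lemma orbit_rep_act g x : orbit_rep (act g x) = orbit_rep x.
Proof.
rewrite /orbit_rep.
rewrite (@eq_choose _ _ (fun y => `[< exists g, act g x = y >])) => [|y].
  by apply: choose_id; apply/asboolP; [exists g | exists 1%g].
apply/asbool_equiv_eq; split=> -[h <-].
  by exists (h * g)%g; rewrite actM.
by exists (h * g^-1)%g; rewrite actM -[act _ (act g x)]actM mulVg act1.
Qed.

Lemma orbit_bij :
  set_bij ([set t | orbit_rep t = t] `*` [set: G]) [set: X]
          (fun p => act p.2 p.1).
Proof.
split=> [//||x _].
  move=> [t g] [s h]; rewrite !inE /= => -[tt _] [ss _] e.
  have ts : t = s by rewrite -tt -ss -(orbit_rep_act g t) e orbit_rep_act.
  by rewrite -ts in e *; rewrite (act_inj e).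
have [g gx] := orbit_repP x; exists (orbit_rep x, g^-1%g).
  by split=> //; rewrite /= -{1}gx orbit_rep_act.
by rewrite /= -gx -actM mulVg act1.
Qed.

Lemma sqsum_orbits (F : X -> C) :
  sqsum F = (\esum_(t in [set t | orbit_rep t = t]) sqsum (fun g => F (act g t)))%E.
Proof.
rewrite /sqsum (reindex_esum _ _ (fun p => act p.2 p.1) _ orbit_bij).
rewrite esum_esum => [//|t g _ _]; by rewrite lee_fin sqr_ge0.
Qed.

(** The point [x] corresponds to 1 under its own orbit map. By [pull_act] a change of base point
    within the orbit is a right translation, so for right-invariant [a] the values on the whole
    orbit are those of the single family [a (pull x F)]. *)
Definition amplify_fun a F x : C := a (pull x F) 1%g.

Lemma amplify_fun_act a F g x : right_invariant a ->
  amplify_fun a F (act g x) = a (pull x F) g.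
Proof. by move=> ra; rewrite /amplify_fun pull_act rinv_comm //= mul1g. Qed.

Lemma sqsum_amplify a F M : right_invariant a -> 0 <= M ->
  (forall f, norm2 (a f) <= M * norm2 f) ->
  (sqsum (amplify_fun a F) <= ((M * norm2 F) ^+ 2)%:E)%E.
Proof.
move=> ra M0 aM.
have nM : normc (M%:C : C) = M by rewrite /= expr0n addr0 sqrtr_sqr ger0_norm.
(* Reading [M * norm2 F] as the norm of a multiple of [F] makes both sides sums over orbits, to be
   compared orbit by orbit. *)
rewrite -[in leRHS]nM -norm2Z norm2_sqrE !sqsum_orbits; apply: le_esum => t _.
have -> : (fun g => amplify_fun a F (act g t)) = a (pull t F).
  by apply/funext => g; exact: amplify_fun_act.
have -> : (fun g => (M%:C *: F) (act g t)) = M%:C *: pull t F.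
  by apply/funext => g.
by rewrite -!norm2_sqrE lee_fin ler_sqr ?nnegrE ?norm2_ge0 // norm2Z nM.
Qed.

(* This is the operator [a] acting diagonally on the decomposition of
   [ell2 R X] into one copy of [ell2 R G] per orbit. *)
Definition amplify a (F : ell2 R X) : ell2 R X := insubd 0 (amplify_fun a F).

(** The orbitwise bound makes [amplify_fun a F] square-summable, so the default 0 of [amplify] does
    not intervene. *)
Lemma amplifyE a F x : right_invariant a -> amplify a F x = a (pull x F) 1%g.
Proof.
move=> ra; rewrite [LHS](_ : _ = amplify_fun a F x) //.
rewrite -[LHS]/(val (insubd 0 _) x) insubdK //; apply/asboolP.
have [M M0 aM] := rinv_bounded ra.
exact: le_lt_trans (sqsum_amplify F ra M0 aM) (ltry _).
Qed.

Lemma amplify_bounded a M F : right_invariant a -> 0 <= M ->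
  (forall f, norm2 (a f) <= M * norm2 f) -> norm2 (amplify a F) <= M * norm2 F.
Proof.
move=> ra M0 aM; rewrite -[_ <= _]ler_sqr ?nnegrE ?mulr_ge0 ?norm2_ge0 //.
rewrite -lee_fin norm2_sqrE; apply: le_trans (sqsum_amplify F ra M0 aM).
by rewrite (_ : ell2_fun _ = amplify_fun a F) //; apply/funext => x; exact: amplifyE.
Qed.

Lemma pull_amplify a x F : right_invariant a ->
  pull x (amplify a F) = a (pull x F).
Proof.
by move=> ra; apply: ell2_ext => g; rewrite /= amplifyE // [LHS]amplify_fun_act.
Qed.

Lemma pullK x : cancel (push x) (pull x).
Proof. exact: extendK. Qed.

Lemma pull_push_out x y f : (forall g, act g x <> y) -> pull y (push x f) = 0.
Proof.
move=> xy; apply: ell2_ext => g; rewrite /= extend_fun_out // => h hg.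
by apply: (xy (g^-1 * h)%g); rewrite actM hg -actM mulVg act1.
Qed.

Lemma amplify_push a x f : right_invariant a ->
  amplify a (push x f) = push x (a f).
Proof.
move=> ra; apply: ell2_ext => y; rewrite amplifyE //.
have [[k <-]|nk] := pselect (exists k, act k x = y).
  by rewrite pull_act pullK rinv_comm //= mul1g extend_fun_im //; exact: act_inj.
rewrite pull_push_out => [|g gx]; last by apply: nk; exists g.
rewrite (linmap0 (rinv_linear ra)) extend_out // => g gx; by apply: nk; exists g.
Qed.

Lemma pull_linear x : linear (pull x).
Proof. exact: restrict_linear. Qed.

Lemma push_linear x : linear (push x).
Proof. exact: extend_linear. Qed.

Lemma norm2_push x f : norm2 (push x f) = norm2 f.
Proof. exact: norm2_extend. Qed.

Lemma amplify_linear a : right_invariant a -> linear (amplify a).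
Proof.
move=> ra c F H; apply: ell2_ext => x; rewrite ell2D ell2Z !amplifyE //.
by rewrite pull_linear (rinv_linear ra).
Qed.

Lemma right_invariant_lin a b c : right_invariant a -> right_invariant b ->
  right_invariant (c *: a + b).
Proof.
move=> ra rb; have [M M0 aM] := rinv_bounded ra; have [N N0 bN] := rinv_bounded rb.
split.
- move=> e f h; rewrite !fctE.
  rewrite (rinv_linear ra) (rinv_linear rb) !scalerDr !scalerA mulrC.
  by rewrite -!addrA; congr (_ + _); rewrite addrCA.
- exists (normc c * M + N); first by rewrite addr_ge0 // mulr_ge0 ?normc_ge0.
  move=> f; rewrite mulrDl; apply: le_trans (norm2D _ _) _; apply: lerD => //.
  by rewrite norm2Z -mulrA ler_wpM2l ?normc_ge0.
- move=> k f; rewrite !fctE (rinv_comm ra) (rinv_comm rb).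
  exact/esym/restrict_linear.
Qed.

Lemma right_invariant_comp a b : right_invariant a -> right_invariant b ->
  right_invariant (a \o b).
Proof.
move=> ra rb; have [M M0 aM] := rinv_bounded ra; have [N N0 bN] := rinv_bounded rb.
split.
- by move=> e f h /=; rewrite (rinv_linear rb) (rinv_linear ra).
- exists (M * N) => [|f]; first exact: mulr_ge0.
  by apply: le_trans (aM _) _; rewrite -mulrA ler_wpM2l.
- by move=> k f /=; rewrite !rinv_comm.
Qed.

Lemma amplify_lin a b c F : right_invariant a -> right_invariant b ->
  amplify (c *: a + b) F = c *: amplify a F + amplify b F.
Proof.
move=> ra rb; apply: ell2_ext => x; rewrite ell2D ell2Z !amplifyE //.
exact: right_invariant_lin.
Qed.

Lemma amplifyM a b F : right_invariant a -> right_invariant b ->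
  amplify (a \o b) F = amplify a (amplify b F).
Proof.
move=> ra rb; apply: ell2_ext => x; rewrite !amplifyE ?pull_amplify //.
exact: right_invariant_comp.
Qed.

Lemma inner_pull x F f : inner (pull x F) f = inner F (push x f).
Proof. exact: inner_restrict. Qed.

Lemma amplify_adjoint a b : right_invariant a -> right_invariant b ->
  (forall f g, inner (a f) g = inner f (b g)) ->
  forall F H, inner (amplify a F) H = inner F (amplify b H).
Proof.
move=> ra rb ab F; have [M M0 bM] := rinv_bounded rb.
apply: (inner_adjoint (M := M)) => [|H|x]; first exact: amplify_linear.
  exact: amplify_bounded.
(* Each basis vector is the image of the one at 1 under its own orbit map, which reduces the claim
   to [a] and [b] on l2(G). *)
have -> : delta x = push x (delta 1%g) by rewrite /push extend_delta act1.
by rewrite amplify_push // -inner_pull -ab inner_delta amplifyE.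
Qed.

Section Positivity.
Variables (K : finType) (B : K -> K -> op).
Hypothesis rB : forall p q, right_invariant (B p q).

Let Q (F H : K -> ell2 R X) : C :=
  \sum_p \sum_q inner (amplify (B p q) (F q)) (H p).

Let QD (F H : K -> ell2 R X) :
  Q (fun p => F p + H p) (fun p => F p + H p) = Q F F + Q F H + Q H F + Q H H.
Proof.
rewrite /Q -!big_split; apply: eq_bigr => p _; rewrite -!big_split /=.
apply: eq_bigr => q _; rewrite (linmapD (amplify_linear (rB p q))).
by rewrite innerDl !innerDr !addrA.
Qed.

Hypothesis B_ge0 :
  forall f : K -> ell2 R G, 0 <= \sum_p \sum_q inner (B p q (f q)) (f p).

(** Induction on base points: [U] is the part of [F] on the orbit of [x] and [V] the rest. Amplified
    operators preserve orbits, so the cross terms vanish, and the [U] term is the hypothesis on [B]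
    at [pull x (F p)]. Since [V] vanishes on the entire orbit, repeated orbits in the list are
    harmless. *)
Lemma amplify_ge0_orbits (s : seq X) (F : K -> ell2 R X) :
  (forall p y, (forall x, x \in s -> forall g, act g x <> y) -> F p y = 0) ->
  0 <= Q F F.
Proof.
elim: s F => [|x s IHs] F F0.
  rewrite /Q big1 // => p _; rewrite big1 // => q _.
  by rewrite (_ : F p = 0) ?inner0r //; apply: ell2_ext => y; apply: F0.
pose U p := push x (pull x (F p)); pose V p := F p - U p.
have pullV p : pull x (V p) = 0.
  by rewrite /V (linmapB (pull_linear x)) /U pullK subrr.
have UVF : (fun p => U p + V p) = F.
  by apply/funext => p; rewrite /V addrCA subrr addr0.
have UV : Q U V = 0.
  rewrite /Q big1 // => p _; rewrite big1 // => q _.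
  by rewrite /U amplify_push // innerC -inner_pull pullV inner0l conjc0.
have VU : Q V U = 0.
  rewrite /Q big1 // => p _; rewrite big1 // => q _.
  rewrite /U -inner_pull pull_amplify // pullV.
  by rewrite (linmap0 (rinv_linear (rB p q))) inner0l.
rewrite -UVF QD UV VU !addr0 addr_ge0 //; last first.
  apply: IHs => p y ys; have [[g <-]|ny] := pselect (exists g, act g x = y).
    by have := congr1 (fun f : ell2 R G => f g) (pullV p).
  rewrite /V ell2D ell2N /U extend_out ?subr0 => [|g gx]; last by apply: ny; exists g.
  by apply: F0 => z; rewrite inE => /orP[/eqP -> g gx|/ys //]; apply: ny; exists g.
have := B_ge0 (fun p => pull x (F p)); congr (_ <= _).
apply: eq_bigr => p _; apply: eq_bigr => q _.
by rewrite /U amplify_push // -inner_pull pullK.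
Qed.

(** Finitely supported families meet finitely many orbits; density and boundedness of the form [Q]
    give the general case. *)
Lemma amplify_ge0 (F : K -> ell2 R X) : 0 <= Q F F.
Proof.
have bndB (pq : K * K) : exists M, 0 <= M /\
    forall f, norm2 (B pq.1 pq.2 f) <= M * norm2 f.
  by have [M M0 BM] := rinv_bounded (rB pq.1 pq.2); exists M.
have [M HM] := choice bndB.
have M0 p q : 0 <= M (p, q) by have [] := HM (p, q).
have MB p q H : norm2 (amplify (B p q) H) <= M (p, q) * norm2 H.
  by apply: amplify_bounded => //; have [] := HM (p, q).
apply: (@complex_near_ge0 _ _
  (\sum_p \sum_q M (p, q) * (norm2 (F p) + norm2 (F q) + 1))).
  apply: sumr_ge0 => p _; apply: sumr_ge0 => q _.
  by rewrite mulr_ge0 ?addr_ge0 ?norm2_ge0.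
move=> e /andP[e0 e1].
have [A HA] := choice (fun p => ell2_dense (F p) e0).
pose H p := \sum_(i <- A p) F p i *: delta i; exists (Q H H).
  apply: (@amplify_ge0_orbits (flatten [seq enum_fset (A p) | p <- enum K])).
  move=> p y ys; rewrite /H ell2_sum big1_seq // => i /andP[_ iA].
  rewrite ell2Z deltaE; case: eqP => [yi|]; last by rewrite mulr0.
  case: (ys i _ 1%g); last by rewrite act1.
  by apply/flatten_mapP; exists p; rewrite // mem_enum.
have FH p : norm2 (F p - H p) <= e by exact: HA.
have Hn p : norm2 (H p) <= norm2 (F p) + 1.
  have -> : H p = F p - (F p - H p) by rewrite opprB addrCA subrr addr0.
  apply: le_trans (norm2D _ _) _; rewrite norm2N lerD2l.
  exact: le_trans (FH p) e1.
rewrite /Q -sumrB mulr_suml; apply: le_trans (@normc_sum _ _ _ _ _) _.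
apply: ler_sum => p _; rewrite -sumrB mulr_suml.
apply: le_trans (@normc_sum _ _ _ _ _) _; apply: ler_sum => q _.
set T := amplify (B p q).
have linT : linear T by exact: amplify_linear.
(* Changing one argument at a time keeps the error linear in [e], as [norm2 (H q)] is at most
   [norm2 (F q) + 1]. *)
have -> : inner (T (F q)) (F p) - inner (T (H q)) (H p) =
    inner (T (F q - H q)) (F p) + inner (T (H q)) (F p - H p).
  by rewrite (linmapB linT) innerBl innerBr; ring.
apply: le_trans (le_normcD _ _) _.
apply: (@le_trans _ _ (M (p, q) * e * norm2 (F p) +
    M (p, q) * (norm2 (F q) + 1) * e)); last first.
  by rewrite le_eqVlt; apply/orP; left; apply/eqP; ring.
apply: lerD; apply: le_trans (cauchy_schwarz _ _) _; apply: ler_pM;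
  rewrite ?norm2_ge0 //; apply: le_trans (MB _ _ _) _; by rewrite ler_wpM2l.
Qed.

End Positivity.

End FreeAction.

(** * The reduced C*-algebra *)

Section OperatorNorm.
Variables (R : realType) (I J : choiceType).
Implicit Types (T : ell2 R I -> ell2 R J).

(** Taken over arbitrary index sets so as to cover both [opnorm] and, through [glue], [mxopnorm]. *)
Definition supnorm T : R := sup [set norm2 (T f) | f in [set f | norm2 f <= 1]].

Lemma supnorm_le T M : (forall f, norm2 (T f) <= M * norm2 f) -> 0 <= M ->
  supnorm T <= M.
Proof.
move=> TM M0; apply: ge_sup; first by exists (norm2 (T 0)), 0; rewrite //= norm2_0.
move=> _ [f /= f1 <-]; apply: le_trans (TM f) _.
by rewrite -[leRHS]mulr1 ler_wpM2l.
Qed.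

Lemma le_supnorm T M : linear T -> (forall f, norm2 (T f) <= M * norm2 f) ->
  forall f, norm2 (T f) <= supnorm T * norm2 f.
Proof.
move=> linT TM f; have [/norm2_eq0 ->|f0] := eqVneq (norm2 f) 0.
  by rewrite (linmap0 linT) !norm2_0 mulr0.
have fpos : 0 < norm2 f by rewrite lt_neqAle eq_sym f0 norm2_ge0.
have nc : normc ((norm2 f)^-1%:C : R[i]) = (norm2 f)^-1.
  by rewrite /= expr0n addr0 sqrtr_sqr ger0_norm // invr_ge0 norm2_ge0.
have -> : norm2 (T f) = norm2 (T ((norm2 f)^-1%:C *: f)) * norm2 f.
  by rewrite (linmapZ linT) norm2Z nc mulrAC mulVf // mul1r.
rewrite ler_pM2r //; apply: ub_le_sup.
  exists `|M| => _ [g /= g1 <-]; apply: le_trans (TM g) _.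
  apply: le_trans (ler_norm _) _; rewrite normrM -[leRHS]mulr1 ler_wpM2l //.
  by rewrite ger0_norm ?norm2_ge0.
by exists ((norm2 f)^-1%:C *: f); rewrite //= norm2Z nc mulVf.
Qed.

Lemma supnorm_ge0 T M : linear T -> (forall f, norm2 (T f) <= M * norm2 f) ->
  0 <= supnorm T.
Proof.
move=> linT TM; apply: ub_le_sup.
  exists `|M| => _ [g /= g1 <-]; apply: le_trans (TM g) _.
  apply: le_trans (ler_norm _) _; rewrite normrM -[leRHS]mulr1 ler_wpM2l //.
  by rewrite ger0_norm ?norm2_ge0.
by exists 0; rewrite /= ?(linmap0 linT) norm2_0.
Qed.

End OperatorNorm.

Section ReducedAlgebra.
Variables (R : realType) (G : groupType).
Local Notation C := R[i].
Local Notation op := (ell2 R G -> ell2 R G).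
Implicit Types (a b : op) (f : ell2 R G) (x y : group_algebra R G).

Lemma left_translation_linear g : linear (@left_translation R G g).
Proof. by move=> c f h; exact: ell2_ext. Qed.

Lemma left_translationE g f : left_translation g f = ell2_restrict (@mulgI G g^-1%g) f.
Proof. exact: ell2_ext. Qed.

Lemma left_regular_sub x (A : {fset G}) f : (finsupp x `<=` A)%fset ->
  left_regular x f = \sum_(g <- A) x g *: left_translation g f.
Proof.
move=> xA; apply: big_fset_incl => // g _.
by rewrite memNfinsupp => /eqP ->; rewrite scale0r.
Qed.

Lemma left_regular_lin c x y :
  exists z, left_regular z = c *: left_regular x + left_regular y.
Proof.
pose A := (finsupp x `|` finsupp y)%fset.
exists [fsfun g in A => c * x g + y g | 0]; apply/funext => f; rewrite !fctE.
rewrite (@left_regular_sub x A) ?fsubsetUl // (@left_regular_sub y A) ?fsubsetUr //.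
rewrite (@left_regular_sub _ A) ?finsupp_sub // scaler_sumr -big_split.
rewrite big_seq [RHS]big_seq; apply: eq_bigr => g gA.
by rewrite fsfunE gA scalerDl scalerA.
Qed.

Lemma left_regular1 g : exists x, left_regular x = @left_translation R G g.
Proof.
exists [fsfun h in [fset g]%fset => 1 | 0]; apply/funext => f.
rewrite (@left_regular_sub _ [fset g]%fset) ?finsupp_sub // big_seq_fset1.
by rewrite fsfunE inE eqxx scale1r.
Qed.

Lemma left_translation_rinv g : right_invariant (@left_translation R G g).
Proof.
split; first exact: left_translation_linear.
  by exists 1 => // f; rewrite mul1r left_translationE norm2_restrict.
by move=> k f; apply: ell2_ext => h /=; rewrite mulgA.
Qed.

Lemma translation_sum_ind (P : op -> Prop) :
  P 0 -> (forall c g T, P T -> P (c *: left_translation g + T)) ->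
  forall x, P (left_regular x).
Proof.
move=> P0 PD x; rewrite /left_regular; elim: (enum_fset _) => [|g s IHs].
  by rewrite (_ : (fun f => _) = 0) //; apply/funext => f; rewrite big_nil.
rewrite (_ : (fun f => _) = x g *: left_translation g +
  (fun f => \sum_(h <- s) x h *: left_translation h f)); first exact: PD.
by apply/funext => f; rewrite big_cons.
Qed.

Lemma rtrans_linear k : linear (@rtrans R G k).
Proof. exact: restrict_linear. Qed.

Lemma op0E f : (0 : op) f = 0. Proof. by []. Qed.

Lemma rinv0 : right_invariant (0 : op).
Proof.
split; first by move=> c f g; rewrite op0E scaler0 addr0.
  by exists 0 => // f; rewrite op0E norm2_0 mul0r.
by move=> k f; rewrite !op0E (linmap0 (@rtrans_linear k)).
Qed.

Lemma left_regular_rinv x : right_invariant (left_regular x).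
Proof.
apply: translation_sum_ind => [|c g T rT]; first exact: rinv0.
by apply: right_invariant_lin => //; exact: left_translation_rinv.
Qed.

Lemma rinvB a b : right_invariant a -> right_invariant b -> right_invariant (a - b).
Proof.
by move=> ra rb; rewrite addrC -scaleN1r; exact: right_invariant_lin.
Qed.

Lemma opB_linear a b : linear a -> linear b -> linear (a - b).
Proof.
move=> la lb c f g; rewrite !fctE la lb scalerBr opprD !addrA.
by congr (_ + _); rewrite addrAC.
Qed.

Lemma opB_bounded a b : bounded_op a -> bounded_op b -> bounded_op (a - b).
Proof.
move=> [M aM] [N bN]; exists (M + N) => f; rewrite mulrDl.
apply: le_trans (norm2D _ _) _; rewrite norm2N; exact: lerD.
Qed.

Lemma rinv_bounded_op a : right_invariant a -> bounded_op a.
Proof. by move=> ra; have [M _ aM] := rinv_bounded ra; exists M. Qed.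

Lemma Cred_approx a e : Cred a -> 0 < e ->
  exists x, forall f, norm2 ((a - left_regular x) f) <= e * norm2 f.
Proof.
move=> [la ba approx] /approx[x xe]; exists x => f.
have rx := left_regular_rinv x.
have [M TM] := opB_bounded ba (rinv_bounded_op rx).
apply: le_trans (le_supnorm (opB_linear la (rinv_linear rx)) TM f) _.
by rewrite ler_wpM2r ?norm2_ge0.
Qed.

(** Left and right translations commute, and commutation with [rtrans k] survives limits in operator
    norm. *)
Lemma Cred_rinv a : Cred a -> right_invariant a.
Proof.
move=> Ca; have [la [M aM] _] := Ca; split => //.
  exists `|M| => // f; apply: le_trans (aM f) _.
  by rewrite ler_wpM2r ?norm2_ge0 ?ler_norm.
move=> k f; apply/eqP; rewrite -subr_eq0; apply/eqP/norm2_eq0/eqP.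
rewrite eq_le norm2_ge0 andbT; apply/ler_addgt0Pr => e e0; rewrite add0r.
(* Two errors of size [e' * norm2 f] must add up to at most [e]; the extra 1 keeps the denominator
   positive when [f = 0]. *)
pose e' := e / (2 * norm2 f + 1).
have D0 : 0 < 2 * norm2 f + 1 by rewrite ltr_wpDl // mulr_ge0 ?norm2_ge0.
have e'0 : 0 < e' by rewrite divr_gt0.
have [x xe] := Cred_approx Ca e'0.
have rx := left_regular_rinv x.
have -> : a (rtrans k f) - rtrans k (a f) =
    (a - left_regular x) (rtrans k f) - rtrans k ((a - left_regular x) f).
  rewrite !fctE (linmapB (@rtrans_linear k)) -(rinv_comm rx).
  by rewrite opprB addrA subrK.
apply: le_trans (norm2D _ _) _; rewrite norm2N.
apply: (@le_trans _ _ (e' * norm2 f + e' * norm2 f)).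
  apply: lerD.
    by apply: le_trans (xe _) _; rewrite ler_wpM2l ?norm2_restrict ?ltW.
  by apply: le_trans (norm2_restrict _ _) _.
rewrite -mulrDr /e' -mulr2n -[norm2 f *+ 2]mulr_natl mulrAC ler_pdivrMr //.
by rewrite ler_wpM2l ?ltW // ltrDl.
Qed.

Lemma CredI a : linear a -> bounded_op a ->
  (forall e, 0 < e ->
    exists x, forall f, norm2 ((a - left_regular x) f) <= e * norm2 f) ->
  Cred a.
Proof.
move=> la ba approx; split=> // e e0; have [x xe] := approx e e0; exists x.
by apply: supnorm_le => //; exact: ltW.
Qed.

Lemma Cred_lim a : linear a -> bounded_op a ->
  (forall e, 0 < e ->
    exists2 b, Cred b & forall f, norm2 ((a - b) f) <= e * norm2 f) ->
  Cred a.
Proof.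
move=> la ba approx; apply: CredI => // e e0.
have e2 : 0 < e / 2 by rewrite divr_gt0.
have [b Cb ab] := approx _ e2; have [x bx] := Cred_approx Cb e2; exists x => f.
have -> : (a - left_regular x) f = (a - b) f + (b - left_regular x) f.
  by rewrite !fctE addrA subrK.
apply: le_trans (norm2D _ _) _; apply: le_trans (lerD (ab f) (bx f)) _.
by rewrite -mulrDl -splitr.
Qed.

Lemma Cred_left_regular x : Cred (left_regular x).
Proof.
have rx := left_regular_rinv x.
apply: CredI => [||e e0]; [exact: rinv_linear | exact: rinv_bounded_op |].
by exists x => f; rewrite subrr norm2_0 mulr_ge0 ?norm2_ge0 ?ltW.
Qed.

Lemma Cred_left_translation g : Cred (@left_translation R G g).
Proof. by have [x <-] := left_regular1 g; exact: Cred_left_regular. Qed.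

Lemma Cred_lin c a b : Cred a -> Cred b -> Cred (c *: a + b).
Proof.
move=> Ca Cb; have rab := right_invariant_lin c (Cred_rinv Ca) (Cred_rinv Cb).
apply: CredI => [||e e0]; [exact: rinv_linear | exact: rinv_bounded_op |].
have c1 : 0 < normc c + 1 by rewrite ltr_wpDl ?normc_ge0.
have e1 : 0 < e / (normc c + 1) by rewrite divr_gt0.
have [x ax] := Cred_approx Ca e1.
have e2 : 0 < e / (normc c + 1) by rewrite divr_gt0.
have [y yb] := Cred_approx Cb e2.
have [z zE] := left_regular_lin c x y; exists z => f; rewrite zE.
have -> : (c *: a + b - (c *: left_regular x + left_regular y)) f =
    c *: (a - left_regular x) f + (b - left_regular y) f.
  by rewrite !fctE scalerBr opprD addrACA.
apply: le_trans (norm2D _ _) _; rewrite norm2Z.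
apply: le_trans (lerD (ler_wpM2l (normc_ge0 c) (ax f)) (yb f)) _.
rewrite mulrA -mulrDl -[X in _ + X]mul1r -mulrDl.
by rewrite [(normc c + 1) * _]mulrC divfK // gt_eqF.
Qed.

Lemma Cred0 : Cred (0 : op).
Proof.
by rewrite -(addNr (@left_translation R G 1%g)) -scaleN1r; apply: Cred_lin;
  exact: Cred_left_translation.
Qed.

Lemma CredZ c a : Cred a -> Cred (c *: a).
Proof. by move=> Ca; rewrite -[c *: a]addr0; apply: Cred_lin Ca Cred0. Qed.

Lemma Cred_sum (K : Type) (s : seq K) (P : pred K) (F : K -> op) :
  (forall i, P i -> Cred (F i)) -> Cred (\sum_(i <- s | P i) F i).
Proof.
move=> CF; elim/big_ind: _ => [|a b Ca Cb|//]; first exact: Cred0.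
by rewrite -[a]scale1r; exact: Cred_lin.
Qed.

(** Takes the place of extension by continuity: [Theta] is already given on all right-invariant
    operators, and linearity with boundedness reduces membership of its values in [Cred] to left
    translations. *)
Lemma Cred_map (Theta : op -> op) (N : R) : 0 <= N ->
  (forall c a b, right_invariant a -> right_invariant b ->
    Theta (c *: a + b) = c *: Theta a + Theta b) ->
  (forall a M, right_invariant a -> 0 <= M ->
    (forall f, norm2 (a f) <= M * norm2 f) ->
    forall f, norm2 (Theta a f) <= N * M * norm2 f) ->
  (forall a, right_invariant a -> linear (Theta a)) ->
  (forall g, Cred (Theta (left_translation g))) ->
  forall a, Cred a -> Cred (Theta a).
Proof.
move=> N0 linTh bTh lTh CTh a Ca; have ra := Cred_rinv Ca.
have Th0 : Theta 0 = 0.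
  have := linTh (-1) 0 0 rinv0 rinv0.
  by rewrite scaleN1r oppr0 addr0 scaleN1r addNr.
have CThx x : Cred (Theta (left_regular x)) /\ right_invariant (left_regular x).
  pattern (left_regular x); apply: translation_sum_ind => [|c g T [CT rT]].
    by rewrite Th0; split; [exact: Cred0 | exact: rinv0].
  have rg := left_translation_rinv g.
  split; last exact: right_invariant_lin.
  by rewrite (linTh c _ _ rg rT); apply: Cred_lin (CTh g) CT.
have N1 : 0 < N + 1 by rewrite ltr_wpDl.
apply: Cred_lim => [||e e0]; first exact: lTh.
  have [M M0 aM] := rinv_bounded ra; exists (N * M).
  exact: (bTh _ _ ra M0 aM).
have e1 : 0 < e / (N + 1) by rewrite divr_gt0.
have [x ax] := Cred_approx Ca e1; have [Cx rx] := CThx x.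
exists (Theta (left_regular x)) => // f.
have -> : Theta a - Theta (left_regular x) = Theta (a - left_regular x).
  by rewrite addrC -scaleN1r -linTh // scaleN1r addrC.
apply: le_trans (bTh _ _ (rinvB ra rx) (ltW e1) ax f) _.
rewrite ler_wpM2r ?norm2_ge0 // mulrA ler_pdivrMr // mulrC ler_wpM2l ?ltW //.
by rewrite ltrDl.
Qed.

End ReducedAlgebra.

(** * Matrices of operators and the averaged compression *)

Section MatrixOperators.
Variables (R : realType) (G : groupType) (J : finType).
Local Notation C := R[i].
Local Notation op := (ell2 R G -> ell2 R G).
Local Notation X := (J * G)%type.
Implicit Types (f g : J -> ell2 R G) (F H : ell2 R X) (A B : J -> J -> op).

Lemma pair_injr (j : J) : injective (fun h : G => (j, h)).
Proof. by move=> g h []. Qed.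

Definition block j : ell2 R X -> ell2 R G := ell2_restrict (@pair_injr j).
Definition inblock j : ell2 R G -> ell2 R X := ell2_extend (@pair_injr j).
Definition glue f : ell2 R X := \sum_j inblock j (f j).

Arguments block : simpl never.
Arguments inblock : simpl never.
Arguments glue : simpl never.

Lemma block_linear j : linear (block j). Proof. exact: restrict_linear. Qed.
Lemma inblock_linear j : linear (inblock j). Proof. exact: extend_linear. Qed.

Lemma blockE j F h : block j F h = F (j, h). Proof. by []. Qed.

Lemma inblockE j (u : ell2 R G) i h : inblock j u (i, h) = if i == j then u h else 0.
Proof.
case: eqVneq => [->|ij]; first exact: extend_im.
by apply: extend_out => k [ji]; rewrite ji eqxx in ij.
Qed.

Lemma glueE f i h : glue f (i, h) = f i h.
Proof.
rewrite ell2_sum (bigD1 i) // inblockE eqxx big1 => [|j ji]; first exact: addr0.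
by rewrite inblockE eq_sym (negbTE ji).
Qed.

Lemma block_glue f i : block i (glue f) = f i.
Proof. by apply: ell2_ext => h; rewrite blockE glueE. Qed.

Lemma glue_block F : glue (block^~ F) = F.
Proof. by apply: ell2_ext => -[i h]; rewrite glueE. Qed.

Lemma inner_block j F (u : ell2 R G) : inner (block j F) u = inner F (inblock j u).
Proof. exact: inner_restrict. Qed.

Lemma inner_inblock j (u : ell2 R G) F : inner (inblock j u) F = inner u (block j F).
Proof. by rewrite innerC -inner_block -innerC. Qed.

Lemma inner_glue f g : inner (glue f) (glue g) = \sum_i inner (f i) (g i).
Proof.
by rewrite inner_sumr; apply: eq_bigr => i _; rewrite -inner_block block_glue.
Qed.

Lemma norm2_glue f : norm2 (glue f) = vnorm2 f.
Proof.
have s0 : 0 <= \sum_i norm2 (f i) ^+ 2 by apply: sumr_ge0 => i _; exact: sqr_ge0.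
apply/eqP; rewrite -(@eqrXn2 _ 2) ?norm2_ge0 ?sqrtr_ge0 // [vnorm2 f ^+ 2]sqr_sqrtr //.
rewrite -(inj_eq (@complexI R)) -inner_self inner_glue rmorph_sum.
by apply/eqP; apply: eq_bigr => i _; exact: inner_self.
Qed.

(** Matrices are moved to l2(J * G), the space on which amplified operators act. *)
Definition mxext A F : ell2 R X := glue (mxop_app A (block^~ F)).

Lemma mxop_appE A f i : mxop_app A f i = \sum_j A i j (f j). Proof. by []. Qed.

Lemma mxopnormE A : mxopnorm A = supnorm (mxext A).
Proof.
congr sup; apply/seteqP; split=> _ [f /= f1 <-].
  exists (glue f); first by rewrite /= norm2_glue.
  rewrite /mxext norm2_glue.
  by congr (vnorm2 (mxop_app A _)); apply/funext => j; exact: block_glue.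
by exists (block^~ f); rewrite /= -?norm2_glue // glue_block.
Qed.

Lemma block_mxext A i F : block i (mxext A F) = \sum_j A i j (block j F).
Proof. by rewrite block_glue. Qed.

Lemma mxext_mul A B F : (forall i j, linear (A i j)) ->
  mxext (mxop_mul A B) F = mxext A (mxext B F).
Proof.
move=> linA; rewrite -[RHS]glue_block; congr glue; apply/funext => i.
rewrite block_mxext mxop_appE.
under [RHS]eq_bigr do rewrite block_mxext (linmap_sum (linA _ _)).
by rewrite exchange_big; apply: eq_bigr => j _; rewrite /mxop_mul !fct_sumE.
Qed.

Lemma mxext_inblock A i j (u : ell2 R G) : (forall i j, linear (A i j)) ->
  block i (mxext A (inblock j u)) = A i j u.
Proof.
move=> linA; rewrite block_mxext (bigD1 j) //= [block j _]extendK big1 ?addr0 //.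
move=> k kj; rewrite (_ : block k _ = 0) ?(linmap0 (linA _ _)) //.
by apply: ell2_ext => h; rewrite blockE inblockE (negbTE kj).
Qed.

Lemma mxext_inj A B : (forall i j, linear (A i j)) ->
  (forall i j, linear (B i j)) -> mxext A =1 mxext B -> A = B.
Proof.
move=> linA linB AB; apply/funext => i; apply/funext => j; apply/funext => u.
by rewrite -mxext_inblock // AB mxext_inblock.
Qed.

Lemma mxext_linear A : (forall i j, linear (A i j)) -> linear (mxext A).
Proof.
move=> linA c F H; rewrite -[LHS]glue_block -[RHS]glue_block; congr glue.
apply/funext => i; rewrite block_linear !block_mxext scaler_sumr -big_split.
by apply: eq_bigr => j _; rewrite block_linear linA.
Qed.

Lemma mxextE A F : mxext A F = \sum_i \sum_j inblock i (A i j (block j F)).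
Proof.
by apply: eq_bigr => i _; rewrite mxop_appE (linmap_sum (inblock_linear i)).
Qed.

Lemma norm2_block j F : norm2 (block j F) <= norm2 F.
Proof. exact: norm2_restrict. Qed.

Lemma norm2_inblock j (u : ell2 R G) : norm2 (inblock j u) = norm2 u.
Proof. exact: norm2_extend. Qed.

Lemma mxext_bounded A : (forall i j, right_invariant (A i j)) ->
  exists M, forall F, norm2 (mxext A F) <= M * norm2 F.
Proof.
move=> rA; have ex (p : J * J) : exists M, 0 <= M /\
    forall u, norm2 (A p.1 p.2 u) <= M * norm2 u.
  by have [M M0 AM] := rinv_bounded (rA p.1 p.2); exists M.
have [M HM] := choice ex.
exists (\sum_i \sum_j M (i, j)) => F; rewrite mxextE mulr_suml.
apply: le_trans (norm2_sum _ _ _) _; apply: ler_sum => i _; rewrite mulr_suml.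
apply: le_trans (norm2_sum _ _ _) _; apply: ler_sum => j _.
have [M0 AM] := HM (i, j); rewrite norm2_inblock; apply: le_trans (AM _) _.
by rewrite ler_wpM2l ?norm2_block.
Qed.

Lemma mxopnorm_ge0 A : (forall i j, right_invariant (A i j)) -> 0 <= mxopnorm A.
Proof.
move=> rA; have [M AM] := mxext_bounded rA; rewrite mxopnormE.
by apply: supnorm_ge0 AM; apply: mxext_linear => i j; exact: rinv_linear.
Qed.

Lemma le_mxopnorm A : (forall i j, right_invariant (A i j)) ->
  forall F, norm2 (mxext A F) <= mxopnorm A * norm2 F.
Proof.
move=> rA; have [M AM] := mxext_bounded rA; rewrite mxopnormE.
by apply: le_supnorm AM; apply: mxext_linear => i j; exact: rinv_linear.
Qed.

(** Regrouping the index ['I_k * J] gives a form in [k] vectors of l2(J * G), the shape in which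
    complete positivity of compression and amplification can be tested. *)
Lemma flatten_mx_pos k (A : 'I_k -> 'I_k -> J -> J -> op) :
  mxop_pos (flatten_mx A) <->
  forall F : 'I_k -> ell2 R X,
    0 <= \sum_p \sum_q inner (mxext (A p q) (F q)) (F p).
Proof.
have key (F : 'I_k -> ell2 R X) (f : 'I_k * J -> ell2 R G) :
    (forall p i, f (p, i) = block i (F p)) ->
    \sum_r inner (mxop_app (flatten_mx A) f r) (f r) =
    \sum_p \sum_q inner (mxext (A p q) (F q)) (F p).
  move=> fF; transitivity (\sum_p \sum_i
      inner (mxop_app (flatten_mx A) f (p, i)) (f (p, i))).
    by rewrite pair_bigA; apply: eq_bigr => -[p i] _.
  apply: eq_bigr => p _.
  transitivity (\sum_i \sum_q
      inner (mxop_app (A p q) (block^~ (F q)) i) (block i (F p))).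
    apply: eq_bigr => i _; rewrite -inner_suml fF; congr inner.
    transitivity (\sum_q \sum_j flatten_mx A (p, i) (q, j) (f (q, j))).
      by rewrite pair_bigA; apply: eq_bigr => -[q j] _.
    by apply: eq_bigr => q _; apply: eq_bigr => j _; rewrite fF.
  rewrite exchange_big; apply: eq_bigr => q _.
  by rewrite /mxext -[F p in RHS]glue_block inner_glue.
split=> [pos F|pos f].
  by rewrite -(key F (fun r => block r.2 (F r.1))) //; exact: pos.
rewrite (key (fun p => glue (fun i => f (p, i)))) // => p i.
by rewrite block_glue.
Qed.

End MatrixOperators.

(** * Skew product of an action by a cocycle, and the averaged compression *)

Section Cocycle.
Variables (R : realType) (G : groupType) (J : finType).
Variables (aJ : G -> J -> J) (sec : G -> J -> G).
Hypothesis aJ1 : forall v, aJ 1%g v = v.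
Hypothesis aJM : forall g h v, aJ (g * h)%g v = aJ g (aJ h v).
Hypothesis sec1 : forall v, sec 1%g v = 1%g.
Hypothesis secM : forall g h v, sec (g * h)%g v = (sec g (aJ h v) * sec h v)%g.
Hypothesis sec_free : forall g v, aJ g v = v -> sec g v = 1%g -> g = 1%g.
Local Notation C := R[i].
Local Notation op := (ell2 R G -> ell2 R G).
Local Notation X := (J * G)%type.

(** The skew product of [aJ] by [sec]; the cocycle identity [secM] makes it an action, and
    [sec_free] makes it free. *)
Definition cact (g : G) (x : X) : X := (aJ g x.1, sec g x.1 * x.2)%g.

Lemma cact1 x : cact 1%g x = x.
Proof. by case: x => v h; rewrite /cact aJ1 sec1 mul1g. Qed.

Lemma cactM g h x : cact (g * h)%g x = cact g (cact h x).
Proof. by rewrite /cact aJM secM mulgA. Qed.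

Lemma cact_free g x : cact g x = x -> g = 1%g.
Proof.
case: x => v h [gv sv]; apply: (sec_free gv).
by apply: (mulIg h); rewrite mul1g.
Qed.

Local Notation push := (push (R := R) cact1 cactM cact_free).
Local Notation pull := (pull (R := R) cact1 cactM cact_free).
Local Notation amplify := (amplify (R := R) cact1 cactM cact_free).

Definition mxamp (a : op) (i j : J) : op :=
  fun f => block i (amplify a (inblock j f)).

Lemma mxampE a i j f h : right_invariant a ->
  mxamp a i j f h = a (pull (i, h) (inblock j f)) 1%g.
Proof. by move=> ra; rewrite /mxamp blockE amplifyE. Qed.

Lemma mxamp_linear a i j : right_invariant a -> linear (mxamp a i j).
Proof.
move=> ra c f g; rewrite /mxamp inblock_linear (amplify_linear _ _ _ ra).
exact: block_linear.
Qed.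

Lemma mxext_mxamp a F : right_invariant a -> mxext (mxamp a) F = amplify a F.
Proof.
move=> ra; rewrite -[RHS]glue_block; congr glue; apply/funext => i.
rewrite mxop_appE -(linmap_sum (block_linear i)).
by rewrite -(linmap_sum (amplify_linear _ _ _ ra)) -[F in RHS]glue_block.
Qed.

Lemma mxamp_lin a b c i j : right_invariant a -> right_invariant b ->
  mxamp (c *: a + b) i j = c *: mxamp a i j + mxamp b i j.
Proof.
move=> ra rb; apply/funext => f; rewrite /mxamp amplify_lin //; exact: block_linear.
Qed.

Lemma mxampM a b : right_invariant a -> right_invariant b ->
  mxamp (a \o b) = mxop_mul (mxamp a) (mxamp b).
Proof.
move=> ra rb; have rab := right_invariant_comp ra rb.
have la i j := mxamp_linear i j ra; have lb i j := mxamp_linear i j rb.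
apply: mxext_inj => [i j|i j c f g|F]; first exact: mxamp_linear.
  rewrite /mxop_mul !fct_sumE scaler_sumr -big_split; apply: eq_bigr => k _.
  by rewrite /= lb la.
by rewrite mxext_mul // !mxext_mxamp // amplifyM.
Qed.

Lemma mxamp_bounded a M i j : right_invariant a -> 0 <= M ->
  (forall f, norm2 (a f) <= M * norm2 f) ->
  forall f, norm2 (mxamp a i j f) <= M * norm2 f.
Proof.
move=> ra M0 aM f; apply: le_trans (norm2_block _ _) _.
by rewrite -[norm2 f](norm2_inblock j); exact: amplify_bounded.
Qed.

(** The amplified translation moves points by [g^-1], and by the cocycle identity
    [sec g^-1 (aJ g j)] is the inverse of [sec g j]; this recovers the recursion matrix of [g]. *)
Lemma mxamp_translation g i j :
  mxamp (left_translation g) i j =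
  if aJ g j == i then left_translation (sec g j) else 0.
Proof.
apply/funext => f; apply: ell2_ext => h.
rewrite mxampE; last exact: left_translation_rinv.
rewrite -[LHS]/(inblock j f (cact (g^-1 * 1)%g (i, h))) mulg1 /cact inblockE /=.
have [<-|gji] := eqVneq (aJ g j) i.
  rewrite -aJM mulVg aJ1 eqxx /=; congr (f (_ * h)%g).
  by apply: (mulIg (sec g j)); rewrite mulVg -secM mulVg sec1.
by case: eqP => // gij; rewrite -gij -aJM mulgV aJ1 eqxx in gji.
Qed.

Lemma mxamp_Cred a i j : Cred a -> Cred (mxamp a i j).
Proof.
apply: (@Cred_map _ _ (fun a => mxamp a i j) 1) => //.
- by move=> c b b' rb rb'; exact: mxamp_lin.
- by move=> b M rb M0 bM f; rewrite mul1r; exact: mxamp_bounded.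
- by move=> b rb; exact: mxamp_linear.
move=> g; rewrite mxamp_translation; case: ifP => _; last exact: Cred0.
exact: Cred_left_translation.
Qed.

Hypothesis J_gt0 : (0 < #|J|)%N.

Let N : C := #|J|%:R.

Let N0 : N != 0. Proof. by rewrite pnatr_eq0 -lt0n. Qed.

Definition compress (T : ell2 R X -> ell2 R X) : op :=
  fun f => N^-1 *: \sum_v pull (v, 1%g) (T (push (v, 1%g) f)).

Lemma normc_invN : normc N^-1 * #|J|%:R = 1.
Proof.
rewrite ComplexField.Normc.normcV.
have -> : normc N = #|J|%:R.
  rewrite /N -(rmorph_nat (real_complex R)) /= expr0n addr0 sqrtr_sqr ger0_norm //.
by rewrite mulVf // pnatr_eq0 -lt0n.
Qed.

Lemma compress_linear T : linear T -> linear (compress T).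
Proof.
move=> lT c f g; rewrite /compress scalerA mulrC -scalerA -scalerDr; congr (_ *: _).
rewrite scaler_sumr -big_split; apply: eq_bigr => v _.
by rewrite push_linear lT pull_linear.
Qed.

Lemma compress_bounded T M : (forall F, norm2 (T F) <= M * norm2 F) ->
  forall f, norm2 (compress T f) <= M * norm2 f.
Proof.
move=> TM f; rewrite norm2Z.
apply: (@le_trans _ _ (normc N^-1 * \sum_(v : J) M * norm2 f)).
  rewrite ler_wpM2l ?normc_ge0 //; apply: le_trans (norm2_sum _ _ _) _.
  apply: ler_sum => v _; apply: le_trans (norm2_restrict _ _) _.
  by apply: le_trans (TM _) _; rewrite norm2_push.
have E : \sum_(v : J) M * norm2 f = #|J|%:R * (M * norm2 f).
  by rewrite sumr_const mulr_natl.
by rewrite E [leLHS]mulrA normc_invN mul1r.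
Qed.

Lemma compress_lin S T c : compress (c *: S + T) = c *: compress S + compress T.
Proof.
apply/funext => f; rewrite !fctE /compress scalerA mulrC -scalerA -scalerDr.
congr (_ *: _); rewrite scaler_sumr -big_split; apply: eq_bigr => v _.
exact: pull_linear.
Qed.

Lemma compress_sum (K : Type) (s : seq K) (P : pred K) F :
  compress (\sum_(k <- s | P k) F k) = \sum_(k <- s | P k) compress (F k).
Proof.
apply: (big_morph compress) => [S T|].
  by have := compress_lin S T 1; rewrite !scale1r.
apply/funext => f; rewrite /compress big1 ?scaler0 // => v _.
exact: (linmap0 (pull_linear _ _ _ _)).
Qed.

Definition entry (u w : J) (a : op) : ell2 R X -> ell2 R X :=
  fun F => inblock u (a (block w F)).

Lemma compress_entryE u w h (f : ell2 R G) g :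
  compress (entry u w (left_translation h)) f g = N^-1 *
  \sum_v (if aJ g v == u then push (v, 1%g) f (w, h^-1 * sec g v)%g else 0).
Proof.
rewrite ell2Z ell2_sum; congr (_ * _); apply: eq_bigr => v _.
rewrite -[LHS]/(entry u w (left_translation h) (push (v, 1%g) f)
  (aJ g v, sec g v * 1)%g).
by rewrite mulg1 inblockE.
Qed.

(* Freeness leaves at most one [k] sending [(w, 1)] to [(u, h)], so that a
   matrix unit times a translation is compressed to a multiple of at most one
   translation. *)
Lemma compress_entry_translation u w h :
  Cred (compress (entry u w (left_translation h))).
Proof.
have [[k [kwu kwh]]|nk] := pselect (exists k, aJ k w = u /\ sec k w = h).
  have -> : compress (entry u w (left_translation h)) = N^-1 *: left_translation k.
    apply/funext => f; apply: ell2_ext => g; rewrite compress_entryE.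
    rewrite -[RHS]/(N^-1 * f (k^-1 * g)%g); congr (_ * _).
    (* At [g] the sole contributing [v] is [g^-1 u], so the condition [aJ g v = u] disappears from
       the sum and the same formula holds for every [g]. *)
    have gz : aJ g (aJ g^-1%g u) = u by rewrite -aJM mulgV aJ1.
    set z := aJ _ u in gz; rewrite (bigD1 z) //= gz eqxx.
    rewrite big1 => [|v vz]; last first.
      case: eqP => // gv; case/eqP: vz.
      by rewrite /z -gv -aJM mulVg aJ1.
    rewrite addr0 -[RHS](extend_im (act_inj cact1 cactM cact_free (x := (z, 1%g)))).
    congr (extend_fun _ _ _).
    rewrite cactM /cact /= gz mulg1 -kwu -aJM mulVg aJ1; congr (_, _).
    rewrite -kwh; congr (_ * _)%g; apply: (mulIg (sec k w)).
    by rewrite mulVg -secM mulVg sec1.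
  exact/CredZ/Cred_left_translation.
have -> : compress (entry u w (left_translation h)) = 0; last exact: Cred0.
apply/funext => f; apply: ell2_ext => g; rewrite compress_entryE big1 ?mulr0 //.
(* A nonzero term would need [m] sending [(v, 1)] to [(w, h^-1 * sec g v)]; then [g * m^-1] would
   send [(w, 1)] to [(u, h)], which is excluded. *)
move=> v _; case: eqP => // gvu; apply: extend_out => m.
rewrite /cact /= mulg1 => -[mw ms]; apply: nk; exists (g * m^-1)%g.
rewrite -mw -aJM mulgVK; split=> //.
apply: (mulIg (sec m v)); rewrite -secM mulgVK ms mulgA.
by rewrite mulgV mul1g.
Qed.

Lemma compress_entry_Cred u w (a : op) : Cred a -> Cred (compress (entry u w a)).
Proof.
apply: (@Cred_map _ _ (fun a => compress (entry u w a)) 1) => //.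
- move=> c b b' _ _; rewrite -compress_lin; congr compress; apply/funext => F.
  exact: inblock_linear.
- move=> b M _ M0 bM f; rewrite mul1r; apply: compress_bounded => F.
  rewrite norm2_inblock; apply: le_trans (bM _) _.
  by rewrite ler_wpM2l ?norm2_block.
- move=> b rb; apply: compress_linear => c F H.
  by rewrite /entry block_linear (rinv_linear rb); exact: inblock_linear.
- by move=> g; exact: compress_entry_translation.
Qed.

Lemma compress_mxext_Cred (A : J -> J -> op) : mxCred A -> Cred (compress (mxext A)).
Proof.
move=> CA; have -> : mxext A = \sum_u \sum_w entry u w (A u w).
  apply/funext => F; rewrite mxextE !fct_sumE; apply: eq_bigr => u _.
  by rewrite fct_sumE.
rewrite compress_sum; apply: Cred_sum => u _; rewrite compress_sum.
by apply: Cred_sum => w _; exact: compress_entry_Cred.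
Qed.

Lemma scaleN (f : ell2 R G) : N^-1 *: \sum_(v : J) f = f.
Proof. by rewrite sumr_const -scaler_nat scalerA mulVf // scale1r. Qed.

Lemma compress_amplify a : right_invariant a -> compress (amplify a) = a.
Proof.
move=> ra; apply/funext => f; rewrite -[RHS]scaleN; congr (_ *: _).
by apply: eq_bigr => v _; rewrite amplify_push // pullK.
Qed.

Lemma compress_amplifyl a T : right_invariant a ->
  compress (amplify a \o T) = a \o compress T.
Proof.
move=> ra; apply/funext => f /=; rewrite (linmapZ (rinv_linear ra)).
rewrite (linmap_sum (rinv_linear ra)); congr (_ *: _).
by apply: eq_bigr => v _; rewrite pull_amplify.
Qed.

Lemma compress_amplifyr a T : right_invariant a ->
  compress (T \o amplify a) = compress T \o a.
Proof.
move=> ra; apply/funext => f /=; congr (_ *: _).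
by apply: eq_bigr => v _; rewrite /= amplify_push.
Qed.

Definition expectation (A : J -> J -> op) : J -> J -> op :=
  mxamp (compress (mxext A)).

Lemma mxCred_rinv A i j : @mxCred R G J A -> right_invariant (A i j).
Proof. by move=> CA; exact: Cred_rinv. Qed.

Lemma mxamp_mxCred a : Cred a -> @mxCred R G J (mxamp a).
Proof. by move=> Ca i j; exact: mxamp_Cred. Qed.

Lemma mxext_mxampE a : right_invariant a -> mxext (mxamp a) = amplify a.
Proof. by move=> ra; apply/funext => F; exact: mxext_mxamp. Qed.

Lemma le_opnorm (a : op) f : right_invariant a -> norm2 (a f) <= opnorm a * norm2 f.
Proof.
move=> ra; have [M _ aM] := rinv_bounded ra.
by apply: le_supnorm aM f; exact: rinv_linear.
Qed.

Lemma opnorm_ge0 (a : op) : right_invariant a -> 0 <= opnorm a.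
Proof.
by move=> ra; have [M _ aM] := rinv_bounded ra; apply: supnorm_ge0 aM; exact: rinv_linear.
Qed.

Lemma mxopnorm_mxamp_le (a : op) : right_invariant a -> mxopnorm (mxamp a) <= opnorm a.
Proof.
move=> ra; rewrite mxopnormE mxext_mxampE //.
apply: supnorm_le (opnorm_ge0 ra) => F; apply: amplify_bounded => //.
  exact: opnorm_ge0.
by move=> f; exact: le_opnorm.
Qed.

Lemma opnorm_compress_le (A : J -> J -> op) : @mxCred R G J A ->
  opnorm (compress (mxext A)) <= mxopnorm A.
Proof.
move=> CA; have rA i j := mxCred_rinv i j CA.
apply: supnorm_le (mxopnorm_ge0 rA) => f.
by apply: compress_bounded; exact: le_mxopnorm.
Qed.

(** For the norm, amplification is bounded orbitwise by [opnorm a], and [compress] is a contractive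
    left inverse, which gives the converse inequality. *)
Lemma mxamp_isometric : isometric_star_morphism mxamp.
Proof.
split.
- by move=> a Ca; exact: mxamp_mxCred.
- move=> c a b /Cred_rinv ra /Cred_rinv rb; apply/funext => i; apply/funext => j.
  exact: mxamp_lin.
- by move=> a b /Cred_rinv ra /Cred_rinv rb; exact: mxampM.
- move=> a b /Cred_rinv ra /Cred_rinv rb ab i j f g; rewrite /mxamp.
  rewrite inner_block (amplify_adjoint _ _ _ ra rb) // -inner_inblock.
  by rewrite innerC -inner_block -innerC.
- move=> a Ca; have ra := Cred_rinv Ca.
  apply/eqP; rewrite eq_le mxopnorm_mxamp_le //=.
  rewrite -[in leLHS](compress_amplify ra) -mxext_mxampE //.
  by apply: opnorm_compress_le; exact: mxamp_mxCred.
Qed.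

Lemma expectation_conditional :
  conditional_expectation (mxamp @` @Cred R G) expectation.
Proof.
split.
- move=> A CA; exists (compress (mxext A)) => //.
  exact: compress_mxext_Cred.
- move=> _ [a /Cred_rinv ra <-].
  by rewrite /expectation mxext_mxampE // compress_amplify.
- move=> c A B CA CB; have rA := Cred_rinv (compress_mxext_Cred CA).
  have rB := Cred_rinv (compress_mxext_Cred CB).
  apply/funext => i; apply/funext => j; rewrite /expectation.
  rewrite (_ : mxext (c *: A + B) = c *: mxext A + mxext B).
    by rewrite compress_lin mxamp_lin.
  apply/funext => F; rewrite -[LHS]glue_block -[RHS]glue_block; congr glue.
  apply/funext => k; rewrite block_linear !block_mxext scaler_sumr -big_split.
  by apply: eq_bigr.
- move=> A CA; apply: le_trans (opnorm_compress_le CA).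
  by apply: mxopnorm_mxamp_le; exact/Cred_rinv/compress_mxext_Cred.
- move=> k A CA /flatten_mx_pos Apos; apply/flatten_mx_pos => F.
  have rA p q : right_invariant (compress (mxext (A p q))).
    exact/Cred_rinv/compress_mxext_Cred.
  under eq_bigr do under eq_bigr do rewrite mxext_mxampE //.
  apply: amplify_ge0 => // f.
  (* Complete positivity of [compress]: it averages the maps T |-> V_v^* T V_v, and each summand is
     the given form evaluated at the vectors [push (v, 1%g) (f p)]. *)
  have -> : \sum_p \sum_q inner (compress (mxext (A p q)) (f q)) (f p) =
      N^-1 * \sum_v \sum_p \sum_q
        inner (mxext (A p q) (push (v, 1%g) (f q))) (push (v, 1%g) (f p)).
    rewrite [in RHS]exchange_big mulr_sumr; apply: eq_bigr => p _.
    rewrite [in RHS]exchange_big mulr_sumr; apply: eq_bigr => q _.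
    rewrite innerZl inner_suml; congr (_ * _); apply: eq_bigr => v _.
    by rewrite inner_pull.
  apply: mulr_ge0; first by rewrite invr_ge0 ler0n.
  by apply: sumr_ge0 => v _; exact: (Apos (fun p => push (v, 1%g) (f p))).
- move=> _ A [a Ca <-] CA; have ra := Cred_rinv Ca.
  have rA := Cred_rinv (compress_mxext_Cred CA).
  rewrite /expectation -mxampM // -compress_amplifyl //; congr mxamp; congr compress.
  apply/funext => F /=; rewrite mxext_mul ?mxext_mxampE // => i j.
  exact: mxamp_linear.
- move=> A _ CA [a Ca <-]; have ra := Cred_rinv Ca.
  have rA := Cred_rinv (compress_mxext_Cred CA).
  rewrite /expectation -mxampM // -compress_amplifyr //; congr mxamp; congr compress.
  apply/funext => F /=; rewrite mxext_mul ?mxext_mxampE // => i j.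
  exact/rinv_linear/mxCred_rinv.
Qed.

End Cocycle.

(** * The recursion of an automaton group *)

Section RecursionCocycle.
Variables (R : realType) (d : nat) (G : groupClosed (tree_aut d)).
Hypothesis autG : generated_by_automaton G.
Hypothesis freeG : topologically_free G.
Local Notation GT := (subgroup_type G).
Local Notation op := (ell2 R GT -> ell2 R GT).
Local Notation L n := (n.-tuple 'I_d).

Lemma level_act_subproof n (g : tree_aut d) (v : L n) : size (g v) == n.
Proof. by rewrite size_tree_aut size_tuple. Qed.

Definition level_act n (g : GT) (v : L n) : L n :=
  Tuple (level_act_subproof (val g) v).

Definition sectionG (v : seq 'I_d) (g : GT) : GT := insubd 1%g (section (val g) v).

Lemma val_sectionG v g : val (sectionG v g) = section (val g) v.
Proof. by rewrite insubdK //; apply: automaton_section => //; exact: valP. Qed.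

(** Translates between the two conventions: [phiG] is indexed by the image vertex, [sectionG] by the
    source vertex. *)
Lemma phiG_section (g : GT) v : phiG (val g v) g = sectionG v g.
Proof.
apply: val_inj; rewrite val_phiG // val_sectionG /phi.
by congr section; exact: tree_aut_Vg.
Qed.

Section Level.
Variable n : nat.
Implicit Types (v : L n) (g h : GT).

Let sec g v := sectionG v g.

Lemma level_act1 v : level_act 1%g v = v.
Proof. exact: val_inj. Qed.

Lemma level_actM g h v : level_act (g * h)%g v = level_act g (level_act h v).
Proof. exact: val_inj. Qed.

Lemma section1 v : sec 1%g v = 1%g.
Proof.
apply: val_inj; rewrite val_sectionG; apply: tree_aut_ext => w.
by apply: (@cat_inj _ v); rewrite -(section_eq 1%g).
Qed.

Lemma sectionGM g h v : sec (g * h)%g v = (sec g (level_act h v) * sec h v)%g.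
Proof. by apply: val_inj; rewrite /= !val_sectionG sectionM. Qed.

(** An element fixing [v] with trivial section there fixes the subtree below [v] pointwise, so
    topological freeness applies. *)
Lemma sectionG_free g v : level_act g v = v -> sec g v = 1%g -> g = 1%g.
Proof.
move=> gv sv; apply: val_inj; apply: (freeG (v := v)); first exact: valP.
have sv1 : section (val g) v = 1%g by rewrite -val_sectionG [sectionG v g]sv.
by move=> w; rewrite section_eq sv1; have /= -> := congr1 val gv.
Qed.

Definition level_amp : op -> L n -> L n -> op :=
  mxamp level_act1 level_actM section1 sectionGM sectionG_free.

Lemma level_ampE a u v f h : right_invariant a -> level_amp a u v f h =
  a (pull (cact1 level_act1 section1) (cactM level_actM sectionGM)
      (cact_free (sec := sec) sectionG_free) (u, h) (inblock v f)) 1%g.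
Proof. exact: mxampE. Qed.

Lemma level_amp_left_regular x u v :
  level_amp (left_regular x) u v = left_regular (recursion x u v).
Proof.
apply/funext => f; apply: ell2_ext => h.
rewrite level_ampE; last exact: left_regular_rinv.
pose A := [fset phiG u g | g in finsupp x]%fset.
rewrite (@left_regular_sub _ _ (recursion x u v) A) ?finsupp_sub //.
rewrite !ell2_sum; under [RHS]eq_bigr do rewrite ell2Z recursionE mulr_suml.
pose F g := if level_act g v == u then x g * f ((phiG u g)^-1 * h)%g else 0.
transitivity (\sum_(g <- finsupp x) F g).
  apply: eq_bigr => g _; rewrite ell2Z.
  rewrite -[left_translation g _ _]/(inblock v f
    (level_act (g^-1 * 1) u, sec (g^-1 * 1) u * h)%g).
  rewrite mulg1 inblockE /F; have [<-|gvu] := eqVneq (level_act g v) u.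
    rewrite -level_actM mulVg level_act1 eqxx /=; congr (_ * f (_ * h)%g).
    rewrite phiG_section; apply: (mulIg (sec g v)).
    by rewrite mulVg -sectionGM mulVg section1.
  case: eqP => [gu|_]; last by rewrite mulr0.
  by rewrite -gu -level_actM mulgV level_act1 eqxx in gvu.
(* Several [g] may share one value of [phiG u]; the coefficients of [recursion] are the sums over
   these fibres. *)
rewrite (partition_big_imfset _ (phiG u)) /=; apply: eq_bigr => k _.
rewrite [LHS]big_mkcond [RHS]big_mkcond; apply: eq_bigr => g _.
rewrite /F -[level_act g v == u]val_eqE /=.
by case: (phiG u g =P k) => [->|_]; rewrite ?andbT ?andbF.
Qed.

End Level.

Lemma cons_behead n (v : L n.+1) : v = thead v :: behead v :> seq _.
Proof. by case/tupleP: v => x v; rewrite theadE. Qed.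

(** Splitting a word into its first letter and the rest, [section_cat] factors the orbit map at
    level [n.+1] through level 1 and then level [n], applied to the section. Membership in [Cred]
    passes to the entries, so the induction hypothesis applies to them. *)
Lemma iter_level_amp n (a : op) (u v : L n) : Cred a ->
  iter_recursion (@level_amp 1) a u v = level_amp a u v.
Proof.
elim: n a u v => [|n IHn] a u v Ca.
  apply/funext => f; apply: ell2_ext => h.
  have ra := Cred_rinv Ca; rewrite level_ampE //=.
  (* At the empty word the section of [g] is [g] itself, so the orbit map of the base point is right
     multiplication by [h], with which [a] commutes. *)
  rewrite (_ : pull _ _ _ _ _ = rtrans h f).
    by rewrite (rinv_comm ra) /= mul1g.
  apply: ell2_ext => g; rewrite -[LHS]/(inblock v f (level_act g u, sectionG u g * h)%g).
  rewrite inblockE (tuple0 u) (tuple0 v) tuple0 /=; congr (f (_ * h)%g).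
  apply: val_inj; rewrite val_sectionG; apply: tree_aut_ext => w.
  by have := section_eq (val g) [::] w; rewrite tree_aut_root.
rewrite [LHS]/= IHn; last exact: mxamp_Cred.
have ra := Cred_rinv Ca.
apply/funext => f; apply: ell2_ext => h; rewrite [RHS]level_ampE //.
rewrite level_ampE; last exact/Cred_rinv/mxamp_Cred.
rewrite level_ampE //; congr (ell2_fun (a _) _).
apply: ell2_ext => g.
set u0 := [tuple thead u]; set v0 := [tuple thead v].
set u1 := [tuple of behead u]; set v1 := [tuple of behead v].
pose k := sectionG u0 g.
rewrite -[RHS]/(inblock v f (level_act g u, sectionG u g * h)%g).
transitivity (if level_act g u0 == v0 then
  (if level_act k u1 == v1 then f (sectionG u1 k * h)%g else 0) else 0).
  rewrite -[LHS]/(inblock v0 (pull _ _ _ (u1, h) (inblock v1 f))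
    (level_act g u0, k * 1)%g) mulg1 inblockE; case: eqP => // _.
  by rewrite -[LHS]/(inblock v1 f (level_act k u1, sectionG u1 k * h)%g) inblockE.
have uE : u = u0 ++ u1 :> seq _ := cons_behead u.
have vE : v = v0 ++ v1 :> seq _ := cons_behead v.
have -> : sectionG u g = sectionG u1 k.
  by apply: val_inj; rewrite !val_sectionG uE section_cat.
rewrite inblockE; have -> : (level_act g u == v) =
    (level_act g u0 == v0) && (level_act k u1 == v1).
  rewrite -!val_eqE /= val_sectionG vE uE section_eq eqseq_cat //.
  by rewrite size_tree_aut.
by case: eqP.
Qed.

End RecursionCocycle.

Theorem theorem5p2 (R : realType) (d : nat) (G : groupClosed (tree_aut d)) :
  (1 < d)%N ->
  generated_by_reversible_automaton G ->
  exists Phi : (ell2 R (subgroup_type G) -> ell2 R (subgroup_type G)) ->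
      1.-tuple 'I_d -> 1.-tuple 'I_d ->
      ell2 R (subgroup_type G) -> ell2 R (subgroup_type G),
    (extends_recursion Phi /\ isometric_star_morphism Phi) /\
    forall n : nat, exists E,
      conditional_expectation
        (iter_recursion Phi (n := n) @` @Cred R (subgroup_type G)) E.
Proof.
move=> d1 [autG freeG].
(* Levels are nonempty, as the average defining [compress] divides by their size. *)
have L_gt0 n : (0 < #|{: n.-tuple 'I_d}|)%N.
  by rewrite card_tuple card_ord expn_gt0 (ltn_trans _ d1).
exists (level_amp (R := R) autG freeG (n := 1)); split.
  split; first by move=> x u v; exact: level_amp_left_regular.
  exact/mxamp_isometric/L_gt0.
(* On [Cred] the iterate of the recursion agrees with the amplification at level [n], so the two
   have the same image. *)
move=> n; rewrite (_ : _ @` _ = level_amp (R := R) autG freeG (n := n) @` @Cred R _).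
  eexists; exact/expectation_conditional/L_gt0.
apply/seteqP; split=> _ [a Ca <-]; exists a => //.
  by apply/funext => u; apply/funext => v; rewrite iter_level_amp.
by apply/funext => u; apply/funext => v; rewrite iter_level_amp.
Qed.
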